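(* Let $(a_k)_{k\in\mathbb{N}}$ be a sequence with $a_k>0$ for all $k\in\mathbb{N}$, and let $\check{\mathcal{E}}$, with domain $\check{\mathcal{D}}$, be the trace of the Bessel Dirichlet form $\mathcal{E}$ (case $n=3$) with respect to $\mu=\sum_{k\in\mathbb{N}}a_k\delta_k$. Let $p\in[1,\infty)$ be such that $$\sum_{k\in\mathbb{N}}\frac{a_k}{k^{p/2}}<\infty .$$ Then $\check{\mathcal{D}}$ embeds compactly into $\ell^p(\mathbb{N},\mu)$.
   Context: $\mathbb{N}=\{1,2,\dots\}$ and $I=(0,\infty)$; $AC(I)$ denotes the (locally) absolutely continuous functions on $I$. Let $dm=2x^2\,dx$ on $I$. The Bessel Dirichlet form (case $n=3$) is the form in $L^2(I,m)$ with $$\mathcal{D}=\{u\in AC(I)\cap L^2(I,m):\ \int_0^\infty (u')^2x^2\,dx<\infty\},\qquad \mathcal{E}[u]=\int_0^\infty (u'(x))^2x^2\,dx .$$ For $\lambda>0$, $\mathcal{E}_\lambda[u]=\mathcal{E}[u]+\lambda\int_I u^2\,dm$. Trace with respect to $\mu=\sum_{k\in\mathbb{N}}a_k\delta_k$: $\ell^p(\mathbb{N},\mu)=L^p(\mathbb{N},\mu)$ is the space of real sequences with $\sum_k a_k|u_k|^p<\infty$. Let $D(J)=\{u\in\mathcal{D}:\sum_{k}a_ku(k)^2<\infty\}$ and $J:D(J)\to\ell^2(\mathbb{N},\mu)$, $Ju=u|_{\mathbb{N}}$. For $\lambda>0$ let $P_\lambda$ be the orthogonal projection in $(\mathcal{D},\mathcal{E}_\lambda)$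 onto the $\mathcal{E}_\lambda$-orthogonal complement of $\ker J=\{u\in\mathcal{D}:u(k)=0\ \forall k\in\mathbb{N}\}$, and set $\check{\mathcal{E}}_\lambda[Ju]:=\mathcal{E}_\lambda[P_\lambda u]$ for $u\in D(J)$. Each $\check{\mathcal{E}}_\lambda$ is a closed form in $\ell^2(\mathbb{N},\mu)$ with domain $\operatorname{ran}J$, and the family is monotone increasing in $\lambda$. The trace form $\check{\mathcal{E}}$ is by definition the Mosco limit of $\check{\mathcal{E}}_\lambda$ as $\lambda\downarrow0$. The domain $\check{\mathcal{D}}$ carries the Hilbert norm $\check{\mathcal{E}}_1[u]^{1/2}=(\check{\mathcal{E}}[u]+\|u\|_{\ell^2(\mathbb{N},\mu)}^2)^{1/2}$ (here $\check{\mathcal{E}}_1$ means $\check{\mathcal{E}}$ plus the squared $\ell^2(\mathbb{N},\mu)$-norm, not the approximating form above). *)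

(* Defs.v *)
(* MathComp-Analysis, over an arbitrary realType.
   N = {1, 2, ...} is encoded by nat through k |-> k.+1: a sequence indexed by
   N is a function nat -> R whose value at k is the term of index k.+1. *)
From HB Require Import structures.
From mathcomp Require Import all_boot all_order all_algebra.
From mathcomp Require Import all_classical all_reals all_analysis.

Set Implicit Arguments.
Unset Strict Implicit.
Unset Printing Implicit Defensive.

Import Order.TTheory GRing.Theory Num.Theory.
Import numFieldNormedType.Exports.

Local Open Scope classical_set_scope.
Local Open Scope ring_scope.

(* Elements of function spaces on I = ]0, +oo[ are functions R -> R of which
   only the values on I matter. *)

Definition abs_continuous_itv (R : realType) (a b : R) (u : R -> R) : Prop :=
  forall e : R, 0 < e -> exists2 d : R, 0 < d &
    forall s : seq (R * R),
      all (fun t => (a <= t.1) && (t.1 <= t.2) && (t.2 <= b)) s ->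
      pairwise (fun t t' => (t.2 <= t'.1) || (t'.2 <= t.1)) s ->
      \sum_(t <- s) (t.2 - t.1) < d ->
      \sum_(t <- s) `|u t.2 - u t.1| < e.

Definition loc_abs_continuous (R : realType) (u : R -> R) : Prop :=
  forall a b : R, 0 < a -> a <= b -> abs_continuous_itv a b u.

(* For u locally absolutely continuous, derive1 u is the a.e. derivative; it
   takes a junk value only on the null set where u is not derivable. *)
Definition bessel_dom (R : realType) : set (R -> R) :=
  [set u | [/\ loc_abs_continuous u,
    (\int[@lebesgue_measure R]_(x in `]0%R, +oo[)
       (u x ^+ 2 * (2 * x ^+ 2))%:E < +oo)%E &
    (\int[@lebesgue_measure R]_(x in `]0%R, +oo[)
       (derive1 u x ^+ 2 * x ^+ 2)%:E < +oo)%E]].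

(* The bilinear form of E_lambda; it is meaningful on bessel_dom, where both
   integrands are integrable, and E_lambda[u] is its diagonal. *)
Definition bessel_form (R : realType) (lam : R) (u v : R -> R) : R :=
  \int[@lebesgue_measure R]_(x in `]0, +oo[)
    (derive1 u x * derive1 v x * x ^+ 2) +
  lam * \int[@lebesgue_measure R]_(x in `]0, +oo[) (u x * v x * (2 * x ^+ 2)).

(* The norm and pairing below are those of mu = \sum_k a_k delta_k. *)
Definition lp_norm (R : realType) (a : nat -> R) (p : R) (f : nat -> R)
    : \bar R :=
  ((\sum_(k <oo) (a k * `|f k| `^ p)%:E) `^ p^-1)%E.

Definition lp (R : realType) (a : nat -> R) (p : R) : set (nat -> R) :=
  [set f | (\sum_(k <oo) (a k * `|f k| `^ p)%:E < +oo)%E].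

(* An absolutely convergent series when f and g are in lp a 2. *)
Definition l2_inner (R : realType) (a : nat -> R) (f g : nat -> R) : R :=
  limn (series (fun k => a k * f k * g k)).

Definition lp_cvg (R : realType) (a : nat -> R) (p : R)
    (f_ : nat -> nat -> R) (f : nat -> R) : Prop :=
  lp_norm a p (f_ n \- f) @[n --> \oo] --> 0%E.

Definition l2_weak_cvg (R : realType) (a : nat -> R)
    (f_ : nat -> nat -> R) (f : nat -> R) : Prop :=
  forall g, lp a 2 g -> l2_inner a (f_ n) g @[n --> \oo] --> l2_inner a f g.

Definition restrN (R : realType) (u : R -> R) : nat -> R :=
  fun k => u k.+1%:R.

Definition trace_dom (R : realType) (a : nat -> R) : set (R -> R) :=
  [set u | bessel_dom u /\ lp a 2 (restrN u)].

Definition trace_ker (R : realType) : set (R -> R) :=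
  [set u | bessel_dom u /\ forall k, restrN u k = 0].

Definition bessel_orth (R : realType) (lam : R) (M : set (R -> R))
    : set (R -> R) :=
  [set v | bessel_dom v /\ forall w, M w -> bessel_form lam v w = 0].

(* v is the E_lambda-orthogonal projection of u onto the subspace M. *)
Definition is_bessel_proj (R : realType) (lam : R) (M : set (R -> R))
    (u v : R -> R) : Prop :=
  M v /\ forall w, M w -> bessel_form lam (u \- v) w = 0.

(* For lam > 0, the map J u |-> E_lambda[P_lambda u], extended by +oo outside ran J.  The
   set below has at most one element, and is empty for f outside ran J. *)
Definition trace_approx (R : realType) (a : nat -> R) (lam : R)
    (f : nat -> R) : \bar R :=
  xget +oo%E [set c | exists u v, [/\ trace_dom a u, restrN u = f,
    is_bessel_proj lam (bessel_orth lam (@trace_ker R)) u v &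
    c = (bessel_form lam v v)%:E]].

(* Q is the Mosco limit of Q_ lam in L^2(N, mu) as lam decreases to 0.  Forms
   are identified with functionals on L^2(N, mu) equal to +oo off their
   domain. *)
Definition mosco_limit (R : realType) (a : nat -> R)
    (Q_ : R -> (nat -> R) -> \bar R) (Q : (nat -> R) -> \bar R) : Prop :=
  forall lam : nat -> R, (forall n, 0 < lam n) -> lam n @[n --> \oo] --> 0 ->
    (forall (f_ : nat -> nat -> R) (f : nat -> R),
       (forall n, lp a 2 (f_ n)) -> lp a 2 f -> l2_weak_cvg a f_ f ->
       (Q f <= limn_einf (fun n => Q_ (lam n) (f_ n)))%E) /\
    (forall f : nat -> R, lp a 2 f ->
       exists f_ : nat -> nat -> R,
         [/\ forall n, lp a 2 (f_ n), lp_cvg a 2 f_ f &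
             (limn_esup (fun n => Q_ (lam n) (f_ n)) <= Q f)%E]).

Definition is_trace_form (R : realType) (a : nat -> R)
    (Q : (nat -> R) -> \bar R) : Prop :=
  mosco_limit a (trace_approx a) Q.

Definition form_dom (R : realType) (a : nat -> R) (Q : (nat -> R) -> \bar R)
    : set (nat -> R) :=
  [set f | lp a 2 f /\ (Q f < +oo)%E].

Definition form_norm (R : realType) (a : nat -> R) (Q : (nat -> R) -> \bar R)
    (f : nat -> R) : \bar R :=
  ((Q f + lp_norm a 2 f ^+ 2) `^ 2^-1)%E.

Definition compactly_embeds (R : realType) (a : nat -> R)
    (Q : (nat -> R) -> \bar R) (p : R) : Prop :=
  form_dom a Q `<=` lp a p /\
  forall f_ : nat -> nat -> R, (forall n, form_dom a Q (f_ n)) ->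
    (exists M : R, forall n, (form_norm a Q (f_ n) <= M%:E)%E) ->
    exists phi : nat -> nat, {homo phi : i j / (i < j)%N} /\
      exists2 g : nat -> R, lp a p g & lp_cvg a p (f_ \o phi) g.

(* Main.v *)
Require Import Defs.
From mathcomp Require Import all_boot all_order all_algebra.
From mathcomp Require Import all_classical all_reals all_analysis.
From HB Require Import structures.
From mathcomp Require Import measurable_realfun.
From mathcomp Require Import ring lra.
Import Order.TTheory GRing.Theory Num.Theory.
Import numFieldNormedType.Exports.
Local Open Scope classical_set_scope.
Local Open Scope ring_scope.

Set Implicit Arguments.
Unset Strict Implicit.
Unset Printing Implicit Defensive.

(** Sequences over the positive integers are indexed by nat, the entry of index
    k standing for the integer y = k+1.  The whole argument rests on one
    pointwise inequality, [trace_form_ge]: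

      (k+1) * f(k)^2 <= Etr[f]      for every f in l^2.

    Once it is known, a set that is bounded in the form norm lies in a set
    {f : (k+1) * f(k)^2 <= C for all k}.  On such a set the term a_k |f(k)|^p is
    at most C^(p/2) times a_k / (k+1)^(p/2), which is summable.  This gives the
    inclusion in l^p ([lp_of_decay]).  It also gives compactness: by Tychonoff's
    theorem a sequence in the set has a cluster point for pointwise convergence
    ([decay_cluster]), and since the tails of the l^p series are uniformly small
    the sequence comes arbitrarily close to that point in l^p
    ([decay_lp_close]).

    The inequality passes to the Mosco limit along a recovery sequence, so it
    is enough to prove it for the approximating forms, with a constant that does
    not depend on lambda.  Let v be the projection of u and let y be a positive
    integer.  With s = sqrt(2 lambda), the function

      green(x) = sinh(s x) exp(- s y) / (s y x)    for x <= y,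
      green(x) = sinh(s y) exp(- s x) / (s y x)    for x > y,

    represents the evaluation at y: E_lambda(w, green) = w(y) for every w in the
    domain ([green_reproducing]).  Hence green is orthogonal to ker J.  As u - v
    is orthogonal to everything orthogonal to ker J, testing against green gives
    v(y) = u(y).  Moreover v(y)^2 = E_lambda(v, green)^2 is at most
    E_lambda[v] * E_lambda[green] = E_lambda[v] * green(y), and green(y) <= 1/y.

    The reproducing identity is an integration by parts on ]0, y] and on
    [y, +oo[: the flux x^2 green'(x) has derivative 2 lambda x^2 green(x) away
    from y and drops by 1 at y.  Since w is only locally absolutely continuous,
    the fundamental theorem of calculus has to be proved for such functions
    ([loc_abs_continuous_FTC]).  An absolutely continuous function is a
    difference of two nondecreasing ones ([abs_cont_jordan]); the Stieltjes
    measure of each of these is dominated by the Lebesgue measure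
    ([abs_cont_stieltjes]), so it has a Radon-Nikodym density, and by Lebesgue's
    differentiation theorem that density is the derivative almost everywhere
    ([abs_continuous_density]). *)

(** * Absolute continuity and total variation *)

Section AC.
Context {R : realType}.
Implicit Types (W u F : R -> R) (s r : seq (R * R)) (a b e d x y : R).

Definition ordered_itvs s : bool := all (fun t : R * R => t.1 <= t.2) s.
Definition nonoverlapping s : bool :=
  pairwise (fun t t' : R * R => (t.2 <= t'.1) || (t'.2 <= t.1)) s.
Definition total_length s : R := \sum_(t <- s) (t.2 - t.1).
Definition jumps W s : R := \sum_(t <- s) `|W t.2 - W t.1|.

(** The version on the whole line of [abs_continuous_itv]: composing with [clamp]
    turns a function on a segment into one on the line, so that the interval
    families below need not be confined to the segment. *)
Definition abs_cont W : Prop := forall e, 0 < e -> exists2 d, 0 < d &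
  forall s, ordered_itvs s -> nonoverlapping s -> total_length s < d ->
    jumps W s < e.

Definition clamp a b x : R := Num.max a (Num.min b x).

Lemma clamp_le a b x y : x <= y -> clamp a b x <= clamp a b y.
Proof.
move=> xy; rewrite /clamp ge_max !le_max lexx/= !le_min !ge_min lexx/=.
by rewrite xy !orbT.
Qed.

Lemma clamp_itv a b x : a <= b -> a <= clamp a b x <= b.
Proof. by move=> ab; rewrite /clamp le_max lexx ge_max ab ge_min lexx. Qed.

Lemma clamp_id a b x : a <= x <= b -> clamp a b x = x.
Proof. by move=> /andP[ax xb]; rewrite /clamp (min_idPr xb) (max_idPr ax). Qed.

Lemma clamp_sub a b x y : x <= y -> clamp a b y - clamp a b x <= y - x.
Proof.
move=> xy; rewrite /clamp /Num.max /Num.min.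
by repeat case: ifPn; rewrite -?leNgt; lra.
Qed.

(** [clamp] is monotone and 1-Lipschitz, so it maps a non-overlapping family of
    intervals to another one whose total length is no larger. *)
Lemma abs_cont_clamp a b u : a <= b ->
  abs_continuous_itv a b u -> abs_cont (u \o clamp a b).
Proof.
move=> ab uAC e /uAC[d d0 du]; exists d => // s so sn sd.
pose c (t : R * R) := (clamp a b t.1, clamp a b t.2).
have := du (map c s); rewrite !big_map; apply.
- rewrite all_map; apply: sub_all so => -[x y]/= xy.
  have /andP[-> _] := clamp_itv x ab; have /andP[_ ->] := clamp_itv y ab.
  by rewrite andbT clamp_le.
- rewrite pairwise_map; apply: sub_pairwise sn => -[x y] [x' y']/=.
  by move=> /orP[/(clamp_le a b)->//|/(clamp_le a b)->]; rewrite orbT.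
- apply: le_lt_trans sd; rewrite /total_length big_seq [leRHS]big_seq.
  by apply: ler_sum => t ts; rewrite clamp_sub//; exact: (allP so).
Qed.

Lemma abs_cont_continuous W : abs_cont W -> continuous W.
Proof.
move=> WAC x; apply/cvgrPdist_lt => e /WAC[d d0 dW].
near=> y.
have yx : `|x - y| < d by near: y; exact: cvgr_dist_lt.
have := dW [:: (Num.min x y, Num.max x y)].
rewrite /ordered_itvs /total_length /jumps /nonoverlapping /= !big_seq1 /=.
case: (leP x y) => xy; rewrite !andbT.
- rewrite distrC; apply => //.
  by rewrite -(ger0_norm (_ : 0 <= y - x)) ?subr_ge0// distrC.
- apply => //; first exact: ltW.
  by rewrite -(gtr0_norm (_ : 0 < x - y)) ?subr_gt0.
Unshelve. all: by end_near. Qed.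

(** Seen as the list of its consecutive intervals, a partition becomes a family to
    which absolute continuity applies. *)
Lemma itv_partition_zip a b (l : seq R) : itv_partition a b l ->
  let p := zip (a :: l) l in
  [/\ all (fun t : R * R => (a <= t.1) && (t.1 <= t.2) && (t.2 <= b)) p,
      nonoverlapping p & total_length p = b - a].
Proof.
elim: l a => [|x l ih] a pl /=.
  by split=> //; rewrite /total_length big_nil (itv_partition_nil pl) subrr.
have := pl; rewrite /itv_partition /= => -[/andP[ax _] _].
have pl' := itv_partition_cons pl.
have xb := itv_partition_le pl'.
have [h1 h2 h3] := ih _ pl'; split.
- rewrite lexx (ltW ax) xb /=; apply: sub_all h1 => t /andP[/andP[xt ->] ->].
  by rewrite (le_trans (ltW ax) xt).
- rewrite /nonoverlapping /= -/(nonoverlapping _) h2 andbT.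
  by apply: sub_all h1 => t /andP[/andP[->]].
- by rewrite /total_length big_cons/= [X in _ + X]h3; ring.
Qed.

Lemma jumps_variation W a b (l : seq R) : itv_partition a b l ->
  jumps W (zip (a :: l) l) = variation a b W l.
Proof.
move=> /variation_zip ->; rewrite /jumps.
elim: l (a :: l) => [|x l ih] [|y r]; rewrite ?big_nil// !big_cons.
by rewrite ih.
Qed.

Lemma jumps_cat W s r : jumps W (s ++ r) = jumps W s + jumps W r.
Proof. by rewrite /jumps big_cat. Qed.

Lemma total_length_cat s r :
  total_length (s ++ r) = total_length s + total_length r.
Proof. by rewrite /total_length big_cat. Qed.

(** The modulus of absolute continuity is inherited by the total variation.  The
    intervals are refined one at a time: the list [r] collects the pieces of
    those already replaced by a partition, and taking the supremum over the
    partitions of the next interval turns its jumps into its variation. *)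
Lemma total_variation_jumps W e d :
  (forall s, ordered_itvs s -> nonoverlapping s -> total_length s < d ->
    jumps W s < e) ->
  forall s r, ordered_itvs (r ++ s) -> nonoverlapping (r ++ s) ->
    total_length (r ++ s) < d ->
    ((jumps W r)%:E + \sum_(t <- s) total_variation t.1 t.2 W <= e%:E)%E.
Proof.
move=> HW; elim=> [|t s ih] r.
  by rewrite cats0 big_nil adde0 lee_fin => ? ? ?; apply/ltW/HW.
rewrite /ordered_itvs all_cat /= => /and3P[ro t12 so].
rewrite /nonoverlapping pairwise_cat /= allrel_consr.
move=> /and3P[/andP[rt rs] rn /andP[ts sn]].
rewrite -cat1s !total_length_cat [total_length [:: t]]/total_length big_seq1 => ld.
rewrite big_cons.
set S := (\sum_(t <- s) _)%E.
have S0 : (0 <= S)%E.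
  rewrite /S big_seq; apply: sume_ge0 => q qs.
  by apply: total_variation_ge0; exact: (allP so).
have step (l : seq R) : itv_partition t.1 t.2 l ->
    ((jumps W r)%:E + (variation t.1 t.2 W l)%:E + S <= e%:E)%E.
  move=> pl; rewrite -(jumps_variation W pl) -EFinD -jumps_cat; apply: ih.
  - rewrite /ordered_itvs !all_cat ro so andbT /=.
    have [h _ _] := itv_partition_zip pl.
    by apply: sub_all h => q /andP[/andP[]].
  - have [h1 h2 _] := itv_partition_zip pl.
    rewrite /nonoverlapping !pairwise_cat rn sn andbT /= /allrel all_cat.
    rewrite [all _ r]rs /= -/(nonoverlapping _) h2 andbT /=; apply/andP; split.
    + apply/allP => q /(allP h1)/andP[/andP[tq1 _] tq2].
      apply/allP => q' /(allP ts)/orP[h|h]; apply/orP; [left|right];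
        by [exact: le_trans h|exact: le_trans tq1].
    + apply/allP => q /(allP rt) qt; apply/allP => q' /(allP h1)/andP[/andP[tq1 _] tq2].
      case/orP: qt => h; apply/orP; [left|right].
        exact: le_trans tq1.
      exact: le_trans h.
  - have [_ _ h] := itv_partition_zip pl.
    by rewrite !total_length_cat h; lra.
(* [step] for any one partition already bounds [S]. *)
have SE : S \is a fin_num.
  have p1 : exists l, itv_partition t.1 t.2 l.
    move: t12; rewrite le_eqVlt => /predU1P[->|]; first by exists [::]; split.
    by move=> h; exists [:: t.2]; exact: itv_partition1.
  case: p1 => l /step; rewrite ge0_fin_numE// ltey.
  by apply: contraTneq => ->; rewrite -EFinD.
rewrite -(fineK SE) addeCA -leeBrDr//=.
rewrite -EFinD; apply: ub_ereal_sup => _ [_ [l pl <-] <-].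
have := step _ pl; rewrite -(fineK SE) -!EFinD !lee_fin; lra.
Qed.

(** The interval is cut into finitely many pieces shorter than [d]. *)
Lemma total_variation_lty W d e : 0 < d ->
  (forall x y, x <= y -> y - x < d -> (total_variation x y W <= e%:E)%E) ->
  forall a b, a <= b -> (total_variation a b W < +oo)%E.
Proof.
move=> d0 HW; suff H n a b : a <= b -> b - a < n%:R * (d / 2) ->
    (total_variation a b W < +oo)%E.
  move=> a b ab; apply: (H (Num.bound ((b - a) / (d / 2)))) => //.
  rewrite -ltr_pdivrMr ?divr_gt0//; apply: le_lt_trans (archi_boundP _) => //.
  by rewrite divr_ge0 ?subr_ge0// divr_ge0// ltW.
elim: n a b => [|n ih] a b ab; first by rewrite mul0r subr_lt0 ltNge ab.
have [bad _|dba ban] := ltP (b - a) d.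
  by apply: le_lt_trans (HW _ _ ab bad) _; rewrite ltry.
have ac : a <= b - d / 2 by lra.
have cb : b - d / 2 <= b by lra.
rewrite (total_variationD W ac cb); apply: lte_add_pinfty.
  by apply: ih => //; move: ban; rewrite -natr1 mulrDl mul1r; lra.
by apply: le_lt_trans (HW _ _ cb _) _; rewrite ?ltry//; lra.
Qed.

(** [V x] is the variation of [W] between [a] and [clamp a b x]. *)
Lemma abs_cont_variation W a b : a <= b -> abs_cont W ->
  exists V, [/\ {homo V : x y / x <= y}, abs_cont V &
    forall x y, x <= y -> W (clamp a b y) - W (clamp a b x) <= V y - V x].
Proof.
move=> ab WAC.
have WS e : 0 < e -> exists2 d, 0 < d & forall s, ordered_itvs s ->
    nonoverlapping s -> total_length s < d ->
    (\sum_(t <- s) total_variation t.1 t.2 W <= e%:E)%E.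
  move=> /WAC[d d0 /total_variation_jumps Hd]; exists d => // s so sn sd.
  have := Hd s [::] so sn sd.
  by rewrite /jumps big_nil add0e.
have TVf x y : x <= y -> total_variation x y W \is a fin_num.
  move=> xy; rewrite ge0_fin_numE ?total_variation_ge0//.
  have [d d0 Hd] := WS 1 ltr01.
  apply: total_variation_lty d0 _ _ _ xy => x' y' xy' yd'.
  have := Hd [:: (x', y')]; rewrite /total_length !big_seq1.
  by apply; rewrite // /ordered_itvs /= andbT.
pose V x := fine (total_variation a (clamp a b x) W).
have ac x : a <= clamp a b x by case/andP: (clamp_itv x ab).
have VE x y : x <= y ->
    V y - V x = fine (total_variation (clamp a b x) (clamp a b y) W).
  move=> xy; rewrite /V (total_variationD W (ac x) (clamp_le a b xy)).
  by rewrite fineD ?TVf ?clamp_le// addrAC subrr add0r.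
exists V; split.
- move=> x y xy; rewrite -subr_ge0 VE// fine_ge0//.
  by rewrite total_variation_ge0// clamp_le.
- move=> e e0; have [d d0 Hd] := WS (e / 2) (divr_gt0 e0 (ltr0Sn _ _)).
  exists d => // s so sn sd; rewrite (@le_lt_trans _ _ (e / 2))//; last by lra.
  rewrite -lee_fin; pose c (t : R * R) := (clamp a b t.1, clamp a b t.2).
  apply: le_trans (Hd (map c s) _ _ _).
  + rewrite big_map /jumps -sumEFin big_seq [leRHS]big_seq.
    apply: lee_sum => t ts; have t12 : t.1 <= t.2 by exact: (allP so).
    rewrite VE// ger0_norm ?fine_ge0 ?total_variation_ge0 ?clamp_le//.
    by rewrite fineK// TVf// clamp_le.
  + by rewrite /ordered_itvs all_map; apply: sub_all so => t /= /clamp_le.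
  + rewrite /nonoverlapping pairwise_map; apply: sub_pairwise sn => t t' /=.
    by move=> /orP[/(clamp_le a b)->//|/(clamp_le a b)->]; rewrite orbT.
  + apply: le_lt_trans sd; rewrite /total_length big_map big_seq [leRHS]big_seq.
    by apply: ler_sum => t ts; rewrite clamp_sub//; exact: (allP so).
- move=> x y xy; rewrite VE// -lee_fin fineK ?TVf ?clamp_le//.
  apply: le_trans (total_variation_ge _ (clamp_le a b xy)).
  by rewrite lee_fin ler_norm.
Qed.

(** The two functions are the variation [V] and [V - W]. *)
Lemma abs_cont_jordan W a b : a <= b -> abs_cont W ->
    (forall x, W (clamp a b x) = W x) ->
  exists F1 F2, [/\ {homo F1 : x y / x <= y} /\ {homo F2 : x y / x <= y},
    abs_cont F1 /\ abs_cont F2 &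
    forall x, W x = F1 x - F2 x].
Proof.
move=> ab WAC Wc; have [V [Vnd VAC VW]] := abs_cont_variation ab WAC.
exists V, (fun x => V x - W x); split=> [||x]; last by ring.
- split=> // x y xy; have := VW _ _ xy; rewrite !Wc; lra.
- split=> // e e0; have e20 : 0 < e / 2 by lra.
  have [d1 d10 H1] := VAC _ e20; have [d2 d20 H2] := WAC _ e20.
  exists (Num.min d1 d2); first by rewrite lt_min d10.
  move=> s so sn; rewrite lt_min => /andP[sd1 sd2].
  have := H1 _ so sn sd1; have := H2 _ so sn sd2.
  suff : jumps (fun x => V x - W x) s <= jumps V s + jumps W s by lra.
  rewrite /jumps -big_split/=; apply: ler_sum => t _.
  rewrite [X in `|X|](_ : _ = (V t.2 - V t.1) - (W t.2 - W t.1)); last by ring.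
  exact: ler_normB.
Qed.

End AC.

(** * Null sets of the Stieltjes measure of an absolutely continuous function *)

Section Stieltjes.
Context {R : realType}.
Local Notation mu := (@lebesgue_measure R).
Implicit Types (F : cumulative R R) (W u : R -> R).

Lemma stieltjes_ocitv F (x y : R) : x <= y ->
  lebesgue_stieltjes_measure F `]x, y] = (F y - F x)%:E.
Proof.
move=> xy; rewrite /lebesgue_stieltjes_measure /measure_extension.
rewrite measurable_mu_extE/=; last exact: is_ocitv.
by rewrite wlength_itv_bnd.
Qed.

(** Open components are compared below with the half-open intervals on which a
    Stieltjes measure is defined; the last inclusion uses that an open interval
    does not contain its left end. *)
Lemma open_interval_finite (I : set R) : open I -> is_interval I ->
  (mu I < +oo)%E -> I !=set0 ->
  exists pq : R * R,
    [/\ pq.1 < pq.2, mu I = (pq.2 - pq.1)%:E,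
        `]pq.1, pq.2[ `<=` I & I `<=` `]pq.1, pq.2]].
Proof.
move=> oI /is_intervalP iI.
move: (Rhull I) iI oI => i -> {I}; case: i => -[bl p|[]] [br q|[]] oI;
  rewrite lebesgue_measure_itv /= ?ltry ?ltNyr//=;
  try by [|move=> _ [x] /=; rewrite in_itv/= ?andbF].
move=> _ [x xI].
have near_in y : y \in Interval (BSide bl p) (BSide br q) ->
    exists2 e, 0 < e & forall z, `|y - z| < e ->
      z \in Interval (BSide bl p) (BSide br q).
  move=> Iy.
  have /nbhs_ballP[e e0 He] := open_nbhs_nbhs (conj oI Iy).
  by exists e => // z yz; exact: He.
have inI y : y \in Interval (BSide bl p) (BSide br q) -> p < y <= q.
  move=> yI; have [e e0 He] := near_in _ yI.
  have e20 : 0 < e / 2 by rewrite divr_gt0.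
  have : y - e / 2 \in Interval (BSide bl p) (BSide br q).
    by apply: He; rewrite opprB addrC subrK gtr0_norm//; lra.
  rewrite itv_boundlr => /andP[/lteifW + _].
  by move: yI; rewrite itv_boundlr => /andP[_ /lteifW]; lra.
have /andP[px xq] := inI _ xI.
have pq : p < q by exact: lt_le_trans xq.
exists (p, q); split=> //=.
- by rewrite lte_fin pq.
- by apply: subset_itv; rewrite bnd_simp; case: (bl) => //; case: (br).
Qed.

Lemma stieltjes_interval F (I : set R) (p q : R) : measurable I ->
  p <= q -> I `<=` `]p, q] ->
  (lebesgue_stieltjes_measure F I <= (F q - F p)%:E)%E.
Proof.
move=> mI pq Ipq; rewrite -stieltjes_ocitv//.
by apply: le_measure; rewrite ?inE.
Qed.

(** By outer regularity a null set lies in an open set of small Lebesgue measure,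
    which is a disjoint union of countably many intervals.  The Stieltjes measure
    of finitely many of them is a sum of jumps of [F] over a non-overlapping
    family of small total length. *)
Lemma abs_cont_stieltjes F : abs_cont F ->
  lebesgue_stieltjes_measure F `<< mu.
Proof.
move=> FAC; apply/null_content_dominatesP => A mA muA0.
pose nu := lebesgue_stieltjes_measure F.
apply/eqP; rewrite eq_le measure_ge0 andbT; apply/lee_addgt0Pr => e e0.
rewrite add0e; have [d d0 Hd] := FAC _ e0.
have muAy : (mu A < +oo)%E by rewrite muA0.
have [U [oU AU muUA]] := lebesgue_regularity_outer mA muAy d0.
have mU : measurable U by exact: open_measurable.
have muU : (mu U < d%:E)%E.
  suff -> : mu U = mu (U `\` A) by exact: muUA.
  have := measureDI mu mU mA; rewrite (setIidr AU) muA0 adde0; exact.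
pose I := open_disjoint_itv oU.
have mI i : measurable (I i).
  by apply: open_measurable; exact: open_disjoint_itv_open.
have tI : trivIset setT I by exact: open_disjoint_itv_trivIset.
have UE : U = \bigcup_i I i by exact: open_disjoint_itv_bigcup.
have muI i : (mu (I i) < +oo)%E.
  apply: le_lt_trans (_ : _ <= mu U)%E _; last by rewrite (lt_trans muU) ?ltry.
  apply: le_measure; [by rewrite inE; exact: mI|by rewrite inE|].
  by rewrite UE; exact: bigcup_sup.
have /choice[c cP] : forall i, exists pq : R * R, I i !=set0 ->
    [/\ pq.1 < pq.2, mu (I i) = (pq.2 - pq.1)%:E,
        `]pq.1, pq.2[ `<=` I i & I i `<=` `]pq.1, pq.2]].
  move=> i; have [I0|I0] := pselect (I i !=set0); last by exists (0, 0).
  have [pq pqP] := open_interval_finite (@open_disjoint_itv_open _ _ oU i)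
    (@open_disjoint_itv_is_interval _ _ oU i) (muI i) I0.
  by exists pq.
apply: (@le_trans _ _ (nu U)); first by apply: le_measure; rewrite ?inE.
rewrite UE /nu (measure_bigcup (lebesgue_stieltjes_measure F))//;
  last by move=> i _; exact: mI.
apply: lime_le; first exact: is_cvg_nneseries.
apply: nearW => n.
pose ne i := `[< I i !=set0 >].
pose s := [seq c i | i <- iota 0 n & ne i].
have sumE (m : nat -> \bar R) : (forall i, I i = set0 -> m i = 0%E) ->
    (\sum_(0 <= i < n) m i = \sum_(i <- iota 0 n | ne i) m i)%E.
  move=> m0; rewrite /index_iota subn0 [RHS]big_mkcond/=; apply: eq_bigr => i _.
  case: ifPn => // /asboolPn; rewrite -set0P => /negP; rewrite negbK => /eqP.
  exact: m0.
rewrite (eq_bigl xpredT) => [|i]; last by rewrite in_setT.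
rewrite sumE; last by move=> i ->; rewrite measure0.
apply: (@le_trans _ _ (jumps F s)%:E).
  rewrite /jumps big_map big_filter -sumEFin; apply: lee_sum => i /asboolP i0.
  have [c12 _ _ Ic] := cP _ i0.
  rewrite ger0_norm; last by rewrite subr_ge0 cumulative_is_nondecreasing// ltW.
  by apply: stieltjes_interval => //; exact: ltW.
rewrite lee_fin ltW// Hd//.
- rewrite /ordered_itvs all_map all_filter; apply/allP => i _ /=.
  by apply/implyP => /asboolP /cP[/ltW].
- rewrite /nonoverlapping pairwise_map.
  apply: (@sub_in_pairwise _ ne (fun i j => i != j)).
  + move=> i j /asboolP/cP[ci _ ci1 _] /asboolP/cP[cj _ cj1 _] /= ij.
    (* If neither interval ended before the other, they would share the
       midpoint of their overlap. *)
    apply/orP; have [|ji] := leP (c i).2 (c j).1; first by left.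
    have [|ij'] := leP (c j).2 (c i).1; first by right.
    case/eqP: ij; apply: tI => //.
    exists ((Num.max (c i).1 (c j).1 + Num.min (c i).2 (c j).2) / 2).
    split; [apply: ci1|apply: cj1]; rewrite /= in_itv/= /Num.max /Num.min;
      by do 2 case: ifPn; rewrite -?leNgt => *; apply/andP; split; lra.
  + exact: filter_all.
  + by rewrite -uniq_pairwise filter_uniq// iota_uniq.
- rewrite -lte_fin; apply: le_lt_trans muU.
  rewrite /total_length big_map big_filter -sumEFin.
  rewrite (eq_bigr (fun i => mu (I i))); last by move=> i /asboolP/cP[].
  rewrite -(sumE (fun i => mu (I i))); last by move=> i ->; exact: measure0.
  rewrite UE measure_bigcup//; last by move=> i _; exact: mI.
  rewrite [leRHS](eq_eseriesl (Q := xpredT)); last by move=> i; rewrite in_setT.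
  exact: nneseries_lim_ge.
Qed.

End Stieltjes.

(** * Densities and differentiability almost everywhere *)

Section Density.
Context {R : realType}.
Local Notation mu := (@lebesgue_measure R).
Implicit Types (W u F : R -> R).

(** The Radon-Nikodym theorem needs a finite measure: the Stieltjes measure is
    restricted to ]a, b]. *)
Lemma monotone_density F (a b : R) : a <= b -> {homo F : x y / x <= y} ->
  abs_cont F -> exists2 f : R -> R, mu.-integrable setT (EFin \o f) &
    forall x, a <= x <= b -> F x - F a = \int[mu]_(t in `]a, x]) f t.
Proof.
move=> ab Fnd FAC.
have Frc : right_continuous F.
  by apply: right_continuousW; exact: abs_cont_continuous.
pose Fc : cumulative R R := HB.pack F (isCumulative.Build R _ R F Fnd Frc).
pose nu := lebesgue_stieltjes_measure Fc.
have mab : measurable (`]a, b]%classic : set (measurableTypeR R)).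
  exact: measurable_itv.
have nuab : (nu `]a, b]%classic < +oo)%E.
  by rewrite /nu stieltjes_ocitv// ltry.
have [|g [g0 gfin gint gE]] :=
    @radon_nikodym_sigma_finite _ _ R mu (mfrestr mab nuab).
  have /null_content_dominatesP numu : nu `<< mu by exact: abs_cont_stieltjes.
  apply/null_content_dominatesP => A mA A0.
  rewrite /mfrestr /mrestr /=.
  apply/eqP; rewrite eq_le measure_ge0 andbT -(numu _ mA A0).
  apply: le_measure; rewrite ?inE//; first exact: measurableI.
exists (fine \o g).
  by apply: eq_integrable gint => // x _; rewrite /= fineK.
move=> x /andP[ax xb].
rewrite /Rintegral -[LHS]/(fine (F x - F a)%:E); congr fine.
transitivity (nu `]a, x]%classic); first by rewrite /nu stieltjes_ocitv.
transitivity (mfrestr mab nuab `]a, x]%classic).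
  rewrite /mfrestr /mrestr /=; congr nu; rewrite setIidl//.
  by apply: subset_itvl; rewrite bnd_simp.
rewrite gE//; apply: eq_integral => t _.
by rewrite /= fineK.
Qed.

Lemma abs_continuous_density u (a b : R) : a < b ->
  abs_continuous_itv a b u ->
  exists f : R -> R, [/\ mu.-integrable setT (EFin \o f),
    forall x, a <= x <= b -> u x - u a = \int[mu]_(t in `]a, x]) f t &
    {ae mu, forall x, a < x < b -> derivable u x 1 /\ derive1 u x = f x}].
Proof.
move=> ab /(abs_cont_clamp (ltW ab)) WAC.
have Wc x : (u \o clamp a b) (clamp a b x) = (u \o clamp a b) x.
  by rewrite /= (clamp_id (clamp_itv x (ltW ab))).
have [F1 [F2 [[nd1 nd2] [AC1 AC2] WE]]] := abs_cont_jordan (ltW ab) WAC Wc.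
have [f1 if1 f1E] := monotone_density (ltW ab) nd1 AC1.
have [f2 if2 f2E] := monotone_density (ltW ab) nd2 AC2.
pose f x := f1 x - f2 x.
have intf : mu.-integrable setT (EFin \o f).
  rewrite (_ : EFin \o f = (EFin \o f1) \- (EFin \o f2))%E; last first.
    by apply/funext => x.
  exact: integrableB.
have uE x : a <= x <= b -> u x - u a = \int[mu]_(t in `]a, x]) f t.
  move=> xab; rewrite RintegralB//.
  - rewrite -f1E// -f2E//.
    have := WE x; have := WE a.
    by rewrite /= (clamp_id xab) (@clamp_id _ a b a) ?lexx ?(ltW ab)// => -> ->;
      ring.
  - exact: integrableS if1.
  - exact: integrableS if2.
exists f; split=> //.
have locf : locally_integrable setT f.
  by apply: open_integrable_locally => //; exact: openT.
have intfy y : mu.-integrable [set` Interval (BRight a) (BRight y)] (EFin \o f).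
  exact: integrableS intf.
have := FTC1 intfy locf; apply: filterS; first exact: (ae_filter_ringOfSetsType mu).
move=> x Fx /andP[ax xb].
have [|dF F'] := Fx; first by rewrite lte_fin.
have Fd : is_derive x 1 (fun y => u a + \int[mu]_(t in `]a, y]) f t) (f x).
  have dF1 : is_derive x 1 (fun y => \int[mu]_(t in `]a, y]) f t) (f x).
    by apply: DeriveDef => //; rewrite -derive1E.
  have := is_deriveD (is_derive_cst (u a) x 1) dF1.
  by rewrite add0r.
have [du u'] : is_derive x 1 u (f x).
  apply: near_eq_is_derive Fd; near=> y.
  suff yab : a <= y <= b by rewrite -(uE y yab) [LHS]addrC subrK.
  apply/andP; split; apply/ltW; near: y.
    exact: lt_nbhsr.
  exact: lt_nbhsl.
by split; rewrite ?derive1E.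
Unshelve. all: by end_near. Qed.

End Density.

(** * Measurability of the derivative *)

Section Derive1Measurable.
Context {R : realType}.
Local Notation mu := (@lebesgue_measure R).
Implicit Types (W u : R -> R).

Let quot W (h x : R) : R := h^-1 * (W (h + x) - W x).

Let derivable_quot W x : derivable W x 1 = cvg (quot W ^~ x @ (0:R)^').
Proof.
rewrite /derivable /quot.
by under eq_fun do rewrite /= [_%:A]mulr1.
Qed.

(** Differentiability as a Cauchy criterion with countably many parameters; for
    fixed [n] and [m] the condition on [x] is closed when [W] is continuous. *)
Lemma derivable_cauchyP W x : derivable W x 1 <->
  forall n, exists m, forall h k : R, h != 0 -> k != 0 ->
    `|h| < m.+1%:R^-1 -> `|k| < m.+1%:R^-1 ->
    `|quot W h x - quot W k x| <= n.+1%:R^-1.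
Proof.
rewrite derivable_quot.
split=> [/cvg_ex[l /cvgrPdist_lt Wl] n|Hn].
  have n0 : 0 < n.+1%:R^-1 / 2 :> R by rewrite divr_gt0.
  have /nbhs_ballP[d d0 Hd] := Wl _ n0.
  have [m md] : exists m, m.+1%:R^-1 < d :> R.
    exists (Num.bound d^-1).
    rewrite invf_plt ?posrE// (lt_trans (archi_boundP _)) ?ltr_nat//.
    by rewrite invr_ge0 ltW.
  exists m => h k h0 k0 hm km.
  have Hh := Hd h _ h0; have Hk := Hd k _ k0.
  rewrite (le_trans (ler_distD l _ _))// [leRHS]splitr lerD// ltW//.
    by rewrite distrC Hh// /ball/= sub0r normrN (lt_trans hm).
  by rewrite Hk// /ball/= sub0r normrN (lt_trans km).
apply/cauchy_cvgP/cauchy_ballP => e e0.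
have [n ne] : exists n, n.+1%:R^-1 < e :> R.
  exists (Num.bound e^-1).
  rewrite invf_plt ?posrE// (lt_trans (archi_boundP _)) ?ltr_nat//.
  by rewrite invr_ge0 ltW.
have [m Hm] := Hn n.
have m0 : 0 < m.+1%:R^-1 :> R by rewrite invr_gt0.
pose A := [set quot W h x | h in [set h | h != 0 /\ `|h| < m.+1%:R^-1]].
have FA : (quot W ^~ x @ (0:R)^') A.
  apply/nbhs_ballP; exists m.+1%:R^-1 => // h /= hm h0; exists h => //; split=> //.
  by move: hm; rewrite /ball/= sub0r normrN.
exists (A, A) => //= -[p q] /= [[h [h0 hm] <-] [k [k0 km] <-]].
by apply: le_lt_trans ne; exact: Hm.
Qed.

(** The set of differentiability is a countable intersection of countable unions
    of closed sets.  On it the derivative is a limit of continuous difference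
    quotients; off it [derive1] is the default value of [lim], a constant. *)
Lemma continuous_measurable_derive1 W : continuous W ->
  measurable_fun setT (derive1 W).
Proof.
move=> Wc.
have qc h : continuous (quot W h).
  move=> x; apply: cvgM; first exact: cvg_cst.
  apply: cvgB; last exact: Wc.
  apply: (@continuous_comp _ _ _ (fun x => h + x) W); last exact: Wc.
  by apply: cvgD; [exact: cvg_cst|exact: cvg_id].
pose A n m := [set x | forall h k : R, h != 0 -> k != 0 ->
    `|h| < m.+1%:R^-1 -> `|k| < m.+1%:R^-1 ->
    `|quot W h x - quot W k x| <= n.+1%:R^-1].
have cA n m : closed (A n m).
  have -> : A n m = \bigcap_(hk in [set hk : R * R | [/\ hk.1 != 0, hk.2 != 0,
      `|hk.1| < m.+1%:R^-1 & `|hk.2| < m.+1%:R^-1]])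
      [set x | `|quot W hk.1 x - quot W hk.2 x| <= n.+1%:R^-1].
    apply/seteqP; split=> [x Ax [h k] [/= h0 k0 hm km]|x Ax h k h0 k0 hm km].
      exact: Ax.
    exact: (Ax (h, k)).
  apply: closed_bigI => -[h k] _ /=.
  apply: (@preimage_closed _ _ (fun x => `|quot W h x - quot W k x|)
    [set y : R | y <= n.+1%:R^-1]); last exact: closed_le.
  move=> x _; apply: cvg_norm; apply: cvgB; exact: qc.
pose D := \bigcap_n \bigcup_m A n m.
have mD : measurable D.
  apply: bigcapT_measurable => n; apply: bigcupT_measurable => m.
  exact: closed_measurable.
have DP x : D x <-> derivable W x 1.
  rewrite derivable_cauchyP; split=> [Dx n|Hx n _].
    by have [m _ Am] := Dx n Logic.I; exists m.
  by have [m Am] := Hx n; exists m.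
rewrite -(setUv D); apply/measurable_funU; [by []|exact: measurableC|split].
- apply: (@measurable_fun_cvg _ _ _ _ (fun n => quot W (n.+1%:R^-1))).
    by move=> n; apply: measurable_funTS; exact: continuous_measurable_fun.
  move=> x /DP dx.
  have qd : quot W ^~ x @ (0:R)^' --> derive1 W x.
    by move: dx; rewrite derivable_quot.
  apply: cvg_comp qd => P /= P0.
  have : \forall n \near \oo, (n.+1%:R^-1 : R) != 0 -> P n.+1%:R^-1.
    exact: (@cvg_harmonic R _ P0).
  by apply: (@filterS _ (nbhs \oo)) => n; apply; rewrite invr_neq0.
- apply: (@eq_measurable_fun _ _ _ _ _ (cst (point : R))); last exact: measurable_cst.
  move=> x; rewrite inE => nDx; rewrite /= /derive1 dvgP//.
  move=> cW; apply: nDx; apply/DP.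
  by rewrite derivable_quot.
Qed.

End Derive1Measurable.

(** * The fundamental theorem of calculus on the half-line *)

Section FTC.
Context {R : realType}.
Local Notation mu := (@lebesgue_measure R).
Implicit Types (W u G : R -> R).

Lemma near_eq_derive1 u W x : {near x, u =1 W} -> derive1 u x = derive1 W x.
Proof. by move=> uW; rewrite !derive1E; exact: near_eq_derive. Qed.

Lemma near_clamp u (a b x : R) : a < x < b -> {near x, u \o clamp a b =1 u}.
Proof.
move=> /andP[ax xb]; near=> y; rewrite /= clamp_id//; apply/andP; split;
  apply/ltW; near: y; [exact: lt_nbhsr|exact: lt_nbhsl].
Unshelve. all: by end_near. Qed.

Lemma bigcup_pos_itv : `]0, +oo[%classic =
  \bigcup_n (`]n.+1%:R^-1, n.+1%:R[%classic : set R).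
Proof.
apply/seteqP; split=> x /=.
  rewrite in_itv/= andbT => x0.
  exists (Num.bound (Num.max x x^-1)) => //=.
  have xm : Num.max x x^-1 < (Num.bound (Num.max x x^-1)).+1%:R.
    rewrite (lt_trans (archi_boundP _)) ?ltr_nat//.
    by rewrite le_max ltW.
  move: xm; rewrite gt_max => /andP[xm xvm].
  by rewrite in_itv/= invf_plt ?posrE// xvm.
by move=> [n _ /=]; rewrite !in_itv/= andbT => /andP[nx _]; exact: lt_trans nx.
Qed.

Lemma loc_abs_continuous_clamp u (a b : R) : loc_abs_continuous u ->
  0 < a -> a <= b -> abs_cont (u \o clamp a b).
Proof. by move=> uAC a0 ab; apply: abs_cont_clamp => //; exact: uAC. Qed.

Lemma loc_abs_continuous_continuous u x : loc_abs_continuous u -> 0 < x ->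
  {for x, continuous u}.
Proof.
move=> uAC x0.
have x20 : 0 < x / 2 by rewrite divr_gt0.
have xi : x / 2 < x < x + 1 by apply/andP; split; lra.
have Wc : {for x, continuous (u \o clamp (x / 2) (x + 1))}.
  apply: abs_cont_continuous; apply: loc_abs_continuous_clamp => //; lra.
have uW := near_clamp u xi.
rewrite /prop_for /continuous_at -(nbhs_singleton uW).
by apply: cvg_trans Wc; apply: near_eq_cvg.
Qed.

Lemma loc_abs_continuous_measurable u : loc_abs_continuous u ->
  measurable_fun (`]0, +oo[%classic : set R) u.
Proof.
move=> uAC; apply: open_continuous_measurable_fun; first exact: interval_open.
by move=> x; rewrite inE /= in_itv/= andbT => /(loc_abs_continuous_continuous uAC).
Qed.

(** The clamped function is continuous on the whole line and has the same
    derivative on ]1/(n+1), n+1[. *)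
Lemma loc_abs_continuous_measurable_derive1 u : loc_abs_continuous u ->
  measurable_fun (`]0, +oo[%classic : set R) (derive1 u).
Proof.
move=> uAC; rewrite bigcup_pos_itv; apply/measurable_fun_bigcup => // n.
have n0 : 0 < n.+1%:R^-1 :> R by rewrite invr_gt0.
apply: (@eq_measurable_fun _ _ _ _ _
    (derive1 (u \o clamp n.+1%:R^-1 n.+1%:R))).
  move=> x; rewrite inE/= in_itv/= => xn.
  exact/near_eq_derive1/near_clamp.
apply: measurable_funTS; apply: continuous_measurable_derive1.
apply: abs_cont_continuous; apply: loc_abs_continuous_clamp => //.
by rewrite (@le_trans _ _ 1)// ?ler1n// invf_le1// ler1n.
Qed.

Lemma loc_abs_continuous_ae_derivable u : loc_abs_continuous u ->
  {ae mu, forall x, 0 < x -> derivable u x 1}.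
Proof.
move=> uAC.
have H n : {ae mu, forall x, n.+2%:R^-1 < x < n.+2%:R -> derivable u x 1}.
  have n0 : 0 < n.+2%:R^-1 :> R by rewrite invr_gt0.
  have n1 : n.+2%:R^-1 < n.+2%:R :> R.
    by rewrite (@lt_trans _ _ 1)// ?ltr1n// invf_lt1// ltr1n.
  have [f [_ _]] := abs_continuous_density n1 (uAC _ _ n0 (ltW n1)).
  apply: filterS; first exact: (ae_filter_ringOfSetsType mu).
  by move=> x Hx /Hx[].
have : {ae mu, forall x (n : nat), n.+2%:R^-1 < x < n.+2%:R -> derivable u x 1}.
  exact: ae_foralln.
apply: filterS; first exact: (ae_filter_ringOfSetsType mu).
move=> x Hx x0.
have : x \in (`]0, +oo[%classic : set R) by rewrite inE/= in_itv/= x0.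
rewrite bigcup_pos_itv inE => -[n _ /=]; rewrite in_itv/= => /andP[nx xn].
apply: (Hx n); rewrite (lt_trans xn) ?ltr_nat// andbT.
by rewrite (le_lt_trans _ nx)// lef_pV2 ?posrE// ler_nat.
Qed.

(** The density is taken on the larger segment [a, b + 1], so that [b] is an
    interior point and [derive1 u] agrees with it almost everywhere on ]a, b]. *)
Lemma loc_abs_continuous_FTC u (a b : R) : loc_abs_continuous u ->
  0 < a -> a <= b ->
  mu.-integrable `]a, b] (EFin \o derive1 u) /\
  \int[mu]_(x in `]a, b]) derive1 u x = u b - u a.
Proof.
move=> uAC a0 ab; have ab1 : a < b + 1 by lra.
have [f [intf fE fae]] := abs_continuous_density ab1 (uAC _ _ a0 (ltW ab1)).
have mu' : measurable_fun (`]a, b]%classic : set R) (EFin \o derive1 u).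
  apply/measurable_EFinP.
  apply: measurable_funS (loc_abs_continuous_measurable_derive1 uAC) => //.
  by move=> x /=; rewrite !in_itv/= andbT => /andP[ax _]; exact: lt_trans ax.
have intfab : mu.-integrable `]a, b] (EFin \o f) by exact: integrableS intf.
have mf := measurable_int _ intfab.
have aeE : ae_eq mu (`]a, b]%classic) (EFin \o f) (EFin \o derive1 u).
  apply: filterS fae; first exact: (ae_filter_ringOfSetsType mu).
  move=> x Hx /=; rewrite in_itv/= => /andP[ax xb].
  by have [|_ ->//] := Hx; apply/andP; split => //; lra.
split.
  apply/integrableP; split => //.
  have -> : (\int[mu]_(x in `]a, b]) `|(EFin \o derive1 u) x| =
      \int[mu]_(x in `]a, b]) `|(EFin \o f) x|)%E.
    apply/esym/ge0_ae_eq_integral => //; try exact: measurableT_comp.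
    exact: ae_eq_abse aeE.
  by case/integrableP: intfab.
rewrite fE; last by apply/andP; split; lra.
by rewrite /Rintegral; congr fine; apply/esym/ae_eq_integral.
Qed.
End FTC.

(** * Integration by parts *)

Section IBP.
Context {R : realType}.
Local Notation mu := (@lebesgue_measure R).
Implicit Types (u v G : R -> R).

Lemma lipschitz_abs_continuous u (a b K : R) : 0 <= K ->
  (forall x y, a <= x -> x <= y -> y <= b -> `|u y - u x| <= K * (y - x)) ->
  abs_continuous_itv a b u.
Proof.
move=> K0 uK e e0; have K1 : 0 < K + 1 by rewrite ltr_wpDl.
exists (e / (K + 1)); first by rewrite divr_gt0.
move=> s so _ sd.
apply: (@le_lt_trans _ _ ((K + 1) * \sum_(t <- s) (t.2 - t.1))); last first.
  by rewrite mulrC -ltr_pdivlMr.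
rewrite mulr_sumr big_seq [leRHS]big_seq; apply: ler_sum => t ts.
have /andP[/andP[at1 t12] t2b] := allP so _ ts.
rewrite (le_trans (uK _ _ at1 t12 t2b))// ler_wpM2r ?subr_ge0//.
by rewrite lerDl.
Qed.

Lemma abs_continuous_bounded u (a b : R) : a <= b ->
  abs_continuous_itv a b u ->
  exists2 M, 0 < M & forall x, a <= x <= b -> `|u x| <= M.
Proof.
move=> ab uAC.
have Wc := abs_cont_continuous (abs_cont_clamp ab uAC).
have [|c _ cM] := @EVT_max R (fun x => `|(u \o clamp a b) x|) _ _ ab.
  by apply: continuous_subspaceT => x; apply: cvg_norm; exact: Wc.
exists (`|(u \o clamp a b) c| + 1); first by rewrite ltr_wpDl.
move=> x xab; rewrite ler_wpDr//.
by have := cM x; rewrite in_itv/= clamp_id//; apply.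
Qed.

Lemma abs_continuousM u v (a b : R) : a <= b ->
  abs_continuous_itv a b u -> abs_continuous_itv a b v ->
  abs_continuous_itv a b (fun x => u x * v x).
Proof.
move=> ab uAC vAC.
have [M M0 uM] := abs_continuous_bounded ab uAC.
have [N N0 vN] := abs_continuous_bounded ab vAC.
move=> e e0.
have eN : 0 < e / 2 / N by rewrite !divr_gt0.
have eM : 0 < e / 2 / M by rewrite !divr_gt0.
have [d1 d10 H1] := uAC _ eN; have [d2 d20 H2] := vAC _ eM.
exists (Num.min d1 d2); first by rewrite lt_min d10.
move=> s so sn; rewrite lt_min => /andP[/(H1 _ so sn) s1 /(H2 _ so sn) s2].
rewrite ltr_pdivlMr// in s1; rewrite ltr_pdivlMr// in s2.
apply: le_lt_trans (_ : _ <= (\sum_(t <- s) `|u t.2 - u t.1|) * N +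
    (\sum_(t <- s) `|v t.2 - v t.1|) * M) _; last by lra.
rewrite !mulr_suml -big_split/= big_seq [leRHS]big_seq.
apply: ler_sum => t /(allP so)/andP[/andP[at1 t12] t2b].
rewrite (_ : _ - _ = (u t.2 - u t.1) * v t.2 + (v t.2 - v t.1) * u t.1); last by ring.
rewrite (le_trans (ler_normD _ _))// !normrM lerD// ler_wpM2l//.
  by apply: vN; rewrite t2b andbT (le_trans at1).
by apply: uM; rewrite at1 (le_trans t12).
Qed.

Lemma loc_abs_continuousM u v : loc_abs_continuous u -> loc_abs_continuous v ->
  loc_abs_continuous (fun x => u x * v x).
Proof. by move=> uAC vAC a b a0 ab; apply: abs_continuousM => //; auto. Qed.

(** By the mean value theorem, with the maximum of the derivative on the segment as
    the constant. *)
Lemma C1_lipschitz G (g : R -> R) (a b : R) : a <= b ->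
  {within `[a, b], continuous g} ->
  (forall x, a <= x -> is_derive x 1 G (g x)) ->
  exists2 K, 0 <= K &
    forall x y, a <= x -> x <= y -> y <= b -> `|G y - G x| <= K * (y - x).
Proof.
move=> ab gc dG.
have [|c _ cM] := @EVT_max R (fun x => `|g x|) _ _ ab.
  by move=> x; apply: cvg_norm; exact: gc.
exists `|g c| => // x y ax xy yb.
move: xy; rewrite le_eqVlt => /predU1P[->|xy]; first by rewrite !subrr normr0 mulr0.
have [||z zxy ->] := @MVT R G g _ _ xy.
- by move=> z; rewrite in_itv/= => /andP[xz _]; apply: dG; lra.
- apply: derivable_within_continuous => z; rewrite in_itv/= => /andP[xz _].
  by have [] := dG z (le_trans ax xz).
have yx0 : 0 <= y - x by rewrite subr_ge0 ltW.
rewrite normrM (ger0_norm yx0) ler_wpM2r//; apply: cM.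
move: zxy; rewrite !in_itv/= => /andP[xz zy]; apply/andP; split; lra.
Qed.

(** The fundamental theorem of calculus for the product, whose derivative is given
    by the Leibniz rule wherever both factors are differentiable. *)
Lemma integration_by_parts_loc_abs_continuous u v (a b : R) :
  loc_abs_continuous u -> loc_abs_continuous v -> 0 < a -> a <= b ->
  mu.-integrable `]a, b] (fun x => (derive1 u x * v x + u x * derive1 v x)%:E) /\
  \int[mu]_(x in `]a, b]) (derive1 u x * v x + u x * derive1 v x) =
    u b * v b - u a * v a.
Proof.
move=> uAC vAC a0 ab.
have uvAC := loc_abs_continuousM uAC vAC.
have [iuv <-] := loc_abs_continuous_FTC uvAC a0 ab.
have sub : `]a, b]%classic `<=` (`]0, +oo[%classic : set R).
  by move=> x /=; rewrite !in_itv/= andbT => /andP[ax _]; exact: lt_trans ax.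
have mD w : loc_abs_continuous w ->
    measurable_fun (`]a, b]%classic : set R) (derive1 w).
  by move=> wAC; apply: measurable_funS (loc_abs_continuous_measurable_derive1 wAC).
have mw w : loc_abs_continuous w -> measurable_fun (`]a, b]%classic : set R) w.
  by move=> wAC; apply: measurable_funS (loc_abs_continuous_measurable wAC).
have mf : measurable_fun (`]a, b]%classic : set R)
    (fun x => (derive1 u x * v x + u x * derive1 v x)%:E).
  apply/measurable_EFinP.
  by apply: measurable_funD; apply: measurable_funM; auto.
have aeE : ae_eq mu (`]a, b]%classic)
    (EFin \o derive1 (fun x => u x * v x))
    (fun x => (derive1 u x * v x + u x * derive1 v x)%:E).
  have := loc_abs_continuous_ae_derivable vAC.
  have := loc_abs_continuous_ae_derivable uAC.
  apply: filterS2; first exact: (ae_filter_ringOfSetsType mu).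
  move=> x ux vx /=; rewrite in_itv/= => /andP[ax xb].
  have x0 : 0 < x by exact: lt_trans ax.
  congr EFin; rewrite !derive1E.
  have := deriveM (ux x0) (vx x0); rewrite /GRing.mul/= => ->.
  by rewrite /GRing.scale/= addrC; congr +%R; rewrite mulrC.
split.
  apply/integrableP; split => //.
  rewrite (_ : (\int[mu]_(x in `]a, b]) _ = \int[mu]_(x in `]a, b])
    `|(EFin \o derive1 (fun x => (u x * v x)%R)) x|)%E); last first.
    apply/esym/ge0_ae_eq_integral => //; try exact: measurableT_comp.
      by apply: measurableT_comp => //; exact: measurable_int iuv.
    exact: ae_eq_abse aeE.
  by case/integrableP: iuv.
rewrite /Rintegral; congr fine; apply/esym/ae_eq_integral => //.
exact: measurable_int iuv.
Qed.
End IBP.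

(** * Integrability on the Bessel domain *)

Section Bessel.
Context {R : realType}.
Local Notation mu := (@lebesgue_measure R).
Local Notation I0y := (`]0, +oo[%classic : set R).
Implicit Types (f g h u v w : R -> R).

Let mI : measurable I0y. Proof. exact: measurable_itv. Qed.

Lemma integrable_EFinZ (D : set R) f (k : R) : measurable D ->
  mu.-integrable D (EFin \o f) -> mu.-integrable D (EFin \o (fun x => k * f x)).
Proof.
move=> mD fi.
apply: (@eq_integrable _ _ _ mu D mD (fun x => k%:E * (f x)%:E)%E) => //.
exact: integrableZl.
Qed.

Lemma integrable_EFinD (D : set R) f g : measurable D ->
  mu.-integrable D (EFin \o f) -> mu.-integrable D (EFin \o g) ->
  mu.-integrable D (EFin \o (fun x => f x + g x)).
Proof.
move=> mD fi gi.
apply: (@eq_integrable _ _ _ mu D mD (fun x => (f x)%:E + (g x)%:E)%E) => //.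
exact: integrableD.
Qed.

Lemma square_integrableM f g h : measurable_fun I0y f -> measurable_fun I0y g ->
  measurable_fun I0y h -> (forall x, 0 <= h x) ->
  (\int[mu]_(x in I0y) (f x ^+ 2 * h x)%:E < +oo)%E ->
  (\int[mu]_(x in I0y) (g x ^+ 2 * h x)%:E < +oo)%E ->
  mu.-integrable I0y (EFin \o (fun x => f x * g x * h x)).
Proof.
move=> mf mg mh h0 fy gy.
have sq (k : R -> R) : measurable_fun I0y k ->
    (\int[mu]_(x in I0y) (k x ^+ 2 * h x)%:E < +oo)%E ->
    mu.-integrable I0y (EFin \o (fun x => k x ^+ 2 * h x)).
  move=> mk ky; apply/integrableP; split.
    apply/measurable_EFinP; apply: measurable_funM => //.
    exact: measurable_funX.
  apply: le_lt_trans ky; rewrite le_eqVlt; apply/predU1P; left.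
  by apply: eq_integral => x _; rewrite /= ger0_norm// mulr_ge0// sqr_ge0.
apply: (@le_integrable _ _ _ mu _ mI _
  (EFin \o (fun x => f x ^+ 2 * h x + g x ^+ 2 * h x))).
- by apply/measurable_EFinP; apply: measurable_funM => //; exact: measurable_funM.
- move=> x _ /=; rewrite lee_fin.
  have sq0 k : 0 <= (k : R) ^+ 2 * h x by rewrite mulr_ge0// sqr_ge0.
  rewrite [leRHS]ger0_norm ?addr_ge0//.
  rewrite normrM (ger0_norm (h0 x)) -mulrDl ler_wpM2r//.
  have := sqr_ge0 (f x + g x); have := sqr_ge0 (f x - g x).
  by rewrite ler_norml sqrrB sqrrD => ? ?; apply/andP; split; lra.
- by apply: integrable_EFinD => //; exact: sq.
Qed.

(** Pointwise, this is (f - t g)^2 >= 0. *)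
Lemma Rintegral_young f g h (t : R) : (forall x, 0 <= h x) ->
  mu.-integrable I0y (EFin \o (fun x => f x * f x * h x)) ->
  mu.-integrable I0y (EFin \o (fun x => g x * g x * h x)) ->
  mu.-integrable I0y (EFin \o (fun x => f x * g x * h x)) ->
  2 * t * \int[mu]_(x in I0y) (f x * g x * h x) <=
  \int[mu]_(x in I0y) (f x * f x * h x) +
  t ^+ 2 * \int[mu]_(x in I0y) (g x * g x * h x).
Proof.
move=> h0 iff igg ifg.
rewrite -RintegralZl// -[X in _ <= _ + X]RintegralZl// -RintegralD//; last first.
  exact: integrable_EFinZ.
apply: le_Rintegral => //.
- exact: integrable_EFinZ.
- by apply: integrable_EFinD => //; exact: integrable_EFinZ.
- by move=> x _; have := h0 x; have := sqr_ge0 (f x - t * g x); nra.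
Qed.

Lemma bessel_integrable_derive u v : bessel_dom u -> bessel_dom v ->
  mu.-integrable I0y (EFin \o (fun x => derive1 u x * derive1 v x * x ^+ 2)).
Proof.
move=> [uAC _ u'] [vAC _ v'].
have mx : measurable_fun I0y (fun x : R => x ^+ 2) by exact: exprn_measurable.
have mu' := loc_abs_continuous_measurable_derive1 uAC.
have mv' := loc_abs_continuous_measurable_derive1 vAC.
exact: (square_integrableM mu' mv' mx (fun x => sqr_ge0 x) u' v').
Qed.

Lemma bessel_integrable u v : bessel_dom u -> bessel_dom v ->
  mu.-integrable I0y (EFin \o (fun x => u x * v x * (2 * x ^+ 2))).
Proof.
move=> [uAC u2 _] [vAC v2 _].
have mx : measurable_fun I0y (fun x : R => 2 * x ^+ 2).
  by apply: measurable_funM => //; exact: exprn_measurable.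
have x0 (x : R) : 0 <= 2 * x ^+ 2 by rewrite mulr_ge0// sqr_ge0.
have mu0 := loc_abs_continuous_measurable uAC.
have mv0 := loc_abs_continuous_measurable vAC.
exact: (square_integrableM mu0 mv0 mx x0 u2 v2).
Qed.

(** A linearized form of the Cauchy-Schwarz inequality: it is inherited from a
    pointwise inequality, without expanding the form at u - t v, whose derivative
    is only almost everywhere that of u minus t times that of v. *)
Lemma bessel_form_young (lam t : R) u v : 0 <= lam ->
  bessel_dom u -> bessel_dom v ->
  2 * t * bessel_form lam u v <=
  bessel_form lam u u + t ^+ 2 * bessel_form lam v v.
Proof.
move=> lam0 Du Dv; rewrite /bessel_form.
have x0 (x : R) : 0 <= x ^+ 2 by exact: sqr_ge0.
have x20 (x : R) : 0 <= 2 * x ^+ 2 by rewrite mulr_ge0// sqr_ge0.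
have combine (B C D B' C' D' : R) : 2 * t * B <= C + t ^+ 2 * D ->
    2 * t * B' <= C' + t ^+ 2 * D' ->
    2 * t * (B + lam * B') <= C + lam * C' + t ^+ 2 * (D + lam * D').
  by move=> h /(ler_wpM2l lam0); lra.
have H1 := @Rintegral_young (derive1 u) (derive1 v) (fun x => x ^+ 2) t x0
  (bessel_integrable_derive Du Du) (bessel_integrable_derive Dv Dv)
  (bessel_integrable_derive Du Dv).
have H2 := @Rintegral_young u v (fun x => 2 * x ^+ 2) t x20
  (bessel_integrable Du Du) (bessel_integrable Dv Dv) (bessel_integrable Du Dv).
exact: combine H1 H2.
Qed.

Lemma is_derive_oppV (x : R) : x != 0 ->
  is_derive x 1 (fun x : R => - x^-1) (x ^- 2).
Proof.
move=> x0; have := is_deriveN (is_deriveV x0 (is_derive_id x (1 : R))).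
by rewrite /GRing.scale/= mulr1 opprK.
Qed.

Lemma loc_abs_continuous_oppV : loc_abs_continuous (fun x : R => - x^-1).
Proof.
move=> a b a0 ab.
have [|x ax|K K0 H] := @C1_lipschitz R (fun x => - x^-1) (fun x => x ^- 2) a b ab.
- apply: continuous_in_subspaceT => x; rewrite inE/= in_itv/= => /andP[ax _].
  apply: cvgV; first by rewrite expf_neq0// gt_eqF// (lt_le_trans a0).
  by apply: exprn_continuous.
- have x0 : x != 0 by rewrite gt_eqF// (lt_le_trans a0).
  exact: is_derive_oppV.
exact: lipschitz_abs_continuous K0 H.
Qed.

(** Integrate |w'| <= (eta w'^2 t^2 + 1 / (eta t^2)) / 2 and bound the last
    integral by 1/x.  The weight [eta] is free because near 0 it has to grow in
    order to balance the two terms. *)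
Lemma loc_abs_continuous_increment w (eta x y : R) : loc_abs_continuous w ->
  mu.-integrable I0y (EFin \o (fun x => derive1 w x * derive1 w x * x ^+ 2)) ->
  0 < eta -> 0 < x -> x <= y ->
  `|w y - w x| <= (eta * \int[mu]_(t in I0y) (derive1 w t * derive1 w t * t ^+ 2)
     + (eta * x)^-1) / 2.
Proof.
move=> wAC iw eta0 x0 xy.
have sub : `]x, y]%classic `<=` I0y.
  by move=> t /=; rewrite !in_itv/= andbT => /andP[ax _]; exact: lt_trans ax.
have [iw1 <-] := loc_abs_continuous_FTC wAC x0 xy.
have [iv vE] := loc_abs_continuous_FTC loc_abs_continuous_oppV x0 xy.
have dV t : 0 < t -> derive1 (fun x : R => - x^-1) t = t ^- 2.
  move=> t0; have t0' : t != 0 by rewrite gt_eqF.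
  by rewrite derive1E; have [_ ->] := is_derive_oppV t0'.
have iwxy : mu.-integrable `]x, y]
    (EFin \o (fun t => derive1 w t * derive1 w t * t ^+ 2)).
  exact: integrableS iw.
apply: le_trans (le_normr_Rintegral _ iw1) _ => //.
apply: (@le_trans _ _ (\int[mu]_(t in `]x, y])
  (eta / 2 * (derive1 w t * derive1 w t * t ^+ 2) +
   (2 * eta)^-1 * derive1 (fun x : R => - x^-1) t))).
  apply: le_Rintegral => //.
  - exact: integrable_norm.
  - by apply: integrable_EFinD => //; exact: integrable_EFinZ.
  - move=> t txy; have t0 : 0 < t.
      by have := sub _ txy; rewrite /= in_itv/= andbT.
    rewrite dV//.
    rewrite -[derive1 w t * _]expr2 -real_normK ?num_real//.
    have et : eta != 0 /\ t != 0 by rewrite !gt_eqF.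
    rewrite -subr_ge0 (_ : _ - _ =
      (2 * eta)^-1 * (eta * `|derive1 w t| * t - t^-1) ^+ 2); last first.
      by case: et => e0 t0'; field; rewrite e0 t0'.
    by rewrite mulr_ge0 ?sqr_ge0// invr_ge0 mulr_ge0// ltW.
rewrite RintegralD//; [|exact: integrable_EFinZ|exact: integrable_EFinZ].
rewrite RintegralZl// RintegralZl// vE.
have : \int[mu]_(t in `]x, y]) (derive1 w t * derive1 w t * t ^+ 2) <=
   \int[mu]_(t in I0y) (derive1 w t * derive1 w t * t ^+ 2).
  apply: fine_le; [exact: integrable_fin_num|exact: integrable_fin_num|].
  apply: ge0_subset_integral => //; first exact: measurable_int iw.
  by move=> t _; rewrite lee_fin -expr2 mulr_ge0// sqr_ge0.
set E1 := (X in X <= _ -> _); set E2 := (X in _ <= X -> _) => E12.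
have y0 : 0 < y by exact: lt_le_trans xy.
have -> : (eta * E2 + (eta * x)^-1) / 2 =
    eta / 2 * E2 + (2 * eta)^-1 * (- y^-1 - - x^-1) + (2 * eta)^-1 * y^-1.
  by field; rewrite !gt_eqF.
rewrite -[leLHS]addr0 lerD//; last by rewrite mulr_ge0// invr_ge0 ?mulr_ge0// ltW.
by rewrite lerD2r ler_wpM2l// divr_ge0// ltW.
Qed.

End Bessel.

(** * The Green function of the Bessel operator *)

Section Green.
Context {R : realType}.
Local Notation mu := (@lebesgue_measure R).
Local Notation I0y := (`]0, +oo[%classic : set R).
Implicit Types (f g h u v w : R -> R).

(** Dominated convergence for the restrictions of [f]. *)
Lemma cvg_Rintegral_exhaust f (e T : nat -> R) :
  mu.-integrable I0y (EFin \o f) -> (forall n, 0 < e n) ->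
  e n @[n --> \oo] --> 0 -> T n @[n --> \oo] --> +oo ->
  \int[mu]_(x in `]e n, T n]) f x @[n --> \oo] --> \int[mu]_(x in I0y) f x.
Proof.
move=> intf e0 eto0 Ttoy.
have mf := measurable_int _ intf.
pose f_ n := (EFin \o f) \_ `]e n, T n].
have sub n : `]e n, T n]%classic `<=` I0y.
  by move=> x /=; rewrite !in_itv/= andbT => /andP[ex _]; exact: lt_trans ex.
have mI : measurable I0y by exact: measurable_itv.
have [|||||_ _ cv] := @dominated_convergence _ _ R mu I0y mI f_ (EFin \o f)
    (abse \o (EFin \o f)).
- move=> n; apply: measurable_funTS; apply/(measurable_restrictT _ _).1 => //.
  exact: measurable_funS mf.
- exact: mf.
- apply: aeW => x; rewrite /= in_itv/= andbT => x0.
  apply: cvg_near_cst; near=> n; rewrite /f_ patchE mem_set//= in_itv/=.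
  apply/andP; split.
    near: n; exact: (cvgr_lt 0).
  near: n; by move/cvgryPge: Ttoy; exact.
- exact: integrable_abse.
- apply: aeW => x n _ /=; rewrite /f_ patchE; case: ifPn => _ /=.
    exact: lexx.
  by rewrite lee_fin normr0.
have fE n : (\int[mu]_(x in I0y) f_ n x = \int[mu]_(x in `]e n, T n]) (f x)%:E)%E.
  by rewrite /f_ -integral_mkcondr setIidr.
rewrite /Rintegral; apply: fine_cvg; rewrite fineK; last exact: integrable_fin_num.
by rewrite (_ : (fun n => _) = [sequence \int[mu]_(x in I0y) f_ n x]_n%E)//;
  apply/funext => n /=; rewrite fE.
Unshelve. all: by end_near. Qed.

Variables (s y : R).
Hypotheses (s0 : 0 < s) (y0 : 0 < y).

(** The solutions h of h'' = s^2 h: with h(x) = x g(x) this is the Bessel equation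
    (x^2 g')' = s^2 x^2 g. *)
Definition exp_comb (a b x : R) : R := a * expR (s * x) + b * expR (- (s * x)).

(** The flux x^2 g'(x) = x h'(x) - h(x) of g(x) = h(x) / x. *)
Definition exp_comb_flux (a b x : R) : R :=
  x * (s * exp_comb a (- b) x) - exp_comb a b x.

Lemma is_derive_exp_comb (a b x : R) :
  is_derive x 1 (exp_comb a b) (s * exp_comb a (- b) x).
Proof.
rewrite /exp_comb; apply: is_derive_eq.
rewrite /GRing.scale/= !mulr1; ring.
Qed.

Lemma is_derive_exp_comb_flux (a b x : R) :
  is_derive x 1 (exp_comb_flux a b) (x * s ^+ 2 * exp_comb a b x).
Proof.
have d1 := is_derive_exp_comb a b x.
have d2 := is_derive_exp_comb a (- b) x.
rewrite /exp_comb_flux; apply: is_derive_eq.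
rewrite /GRing.scale/= ?opprK !mulr1; ring.
Qed.

Lemma is_derive_exp_comb_quot (a b x : R) : x != 0 ->
  is_derive x 1 (fun x => exp_comb a b x / x) (exp_comb_flux a b x / x ^+ 2).
Proof.
move=> x0; have d1 := is_derive_exp_comb a b x.
apply: (is_derive_eq (is_deriveM d1 (is_deriveV x0 (is_derive_id x (1 : R))))).
by rewrite /exp_comb_flux /GRing.scale/= !mulr1; field.
Qed.

Let A : R := expR (- (s * y)) / (2 * s * y).
Let B : R := (expR (s * y) - expR (- (s * y))) / (2 * s * y).

Definition green x : R :=
  (if x <= y then exp_comb A (- A) x else exp_comb 0 B x) / x.
Definition green_flux x : R :=
  if x <= y then exp_comb_flux A (- A) x else exp_comb_flux 0 B x.

Let A0 : 0 < A.
Proof. by rewrite divr_gt0 ?expR_gt0// !mulr_gt0. Qed.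

Let B0 : 0 < B.
Proof.
rewrite divr_gt0 ?mulr_gt0// subr_gt0 ltr_expR.
by have := mulr_gt0 s0 y0; lra.
Qed.

Let AB : exp_comb A (- A) y = exp_comb 0 B y.
Proof. by rewrite /exp_comb /A /B; field; rewrite !gt_eqF. Qed.

(** The normalization of [A] and [B] makes the flux drop by exactly 1 at [y]. *)
Lemma exp_comb_flux_jump : exp_comb_flux A (- A) y - exp_comb_flux 0 B y = 1.
Proof.
rewrite /exp_comb_flux AB /exp_comb /A /B !opprK.
have := expRxMexpNx_1 (s * y).
set E := expR (s * y); set E' := expR (- (s * y)) => EE.
rewrite (_ : _ - _ = E * E'); first exact: EE.
by field; rewrite !gt_eqF.
Qed.

Let expNle (x : R) : x <= y -> expR (- (s * y)) * expR (s * x) <= 1.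
Proof.
by move=> xy; rewrite -expRD expR_le1 addrC subr_le0 ler_wpM2l// ltW.
Qed.

Let exp_comb_left (x : R) : 0 < x -> x <= y ->
  0 <= exp_comb A (- A) x <= x / y.
Proof.
move=> x0 xy; rewrite /exp_comb mulNr -mulrBr; apply/andP; split.
  rewrite mulr_ge0 ?(ltW A0)// subr_ge0 ler_expR.
  by have := mulr_gt0 s0 x0; lra.
have e0 := expR_gt0 (s * x).
have H : expR (s * x) - expR (- (s * x)) <= expR (s * x) * (2 * s * x).
  have := expR_ge1Dx (- (2 * s * x)).
  rewrite -(ler_pM2l e0) -expRD mulrDr mulr1 mulrN.
  by rewrite (_ : s * x - 2 * s * x = - (s * x)); [lra|ring].
apply: (le_trans (ler_wpM2l (ltW A0) H)).
rewrite (_ : A * _ = expR (- (s * y)) * expR (s * x) * (x / y)); last first.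
  by rewrite /A; field; rewrite !gt_eqF.
by rewrite ler_piMl ?expNle// divr_ge0// ltW.
Qed.

Let exp_comb_flux_left (x : R) : 0 < x -> x <= y ->
  `|exp_comb_flux A (- A) x| <= x / y.
Proof.
move=> x0 xy; have /andP[h0 h1] := exp_comb_left x0 xy.
have sx0 := mulr_gt0 s0 x0.
have e0 := expR_gt0 (- (s * x)).
have ee : expR (- (s * x)) <= expR (s * x) by rewrite ler_expR; lra.
have H : 0 <= x * (s * exp_comb A (- - A) x) <= x / y.
  rewrite /exp_comb opprK -mulrDr; apply/andP; split.
    by rewrite (mulr_ge0 (ltW x0))// (mulr_ge0 (ltW s0))// (mulr_ge0 (ltW A0))//
      addr_ge0 ?expR_ge0.
  apply: (@le_trans _ _ (x * (s * (A * (2 * expR (s * x)))))).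
    rewrite (ler_wpM2l (ltW x0))// (ler_wpM2l (ltW s0))// (ler_wpM2l (ltW A0))//; lra.
  rewrite (_ : x * _ = expR (- (s * y)) * expR (s * x) * (x / y)); last first.
    by rewrite /A; field; rewrite !gt_eqF.
  by rewrite ler_piMl ?expNle// divr_ge0// ltW.
rewrite /exp_comb_flux ler_norml; case/andP: H => H0 H1.
by apply/andP; split; lra.
Qed.

Lemma green_at : green y <= y^-1.
Proof.
rewrite /green lexx ler_pdivrMr// mulVf ?gt_eqF//.
by have /andP[_] := exp_comb_left y0 (lexx y); rewrite divff ?gt_eqF.
Qed.

Let exp_comb_right (x : R) : exp_comb 0 B x = B * expR (- (s * x)).
Proof. by rewrite /exp_comb mul0r add0r. Qed.

Let exp_comb_flux_right (x : R) :
  exp_comb_flux 0 B x = - (B * (expR (- (s * x)) * (1 + s * x))).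
Proof. by rewrite /exp_comb_flux /exp_comb; ring. Qed.

Let K : R := expR (s * y) * (1 + y ^- 2) + B ^+ 2 * (1 + (y^-1 + s) ^+ 2).

Let K0 : 0 <= K.
Proof.
by rewrite addr_ge0// mulr_ge0 ?expR_ge0 ?sqr_ge0 ?addr_ge0// ?sqr_ge0// invr_ge0 sqr_ge0.
Qed.

Let exp_ge1 (x : R) : x <= y -> 1 <= expR (s * y) * expR (- (s * x)).
Proof.
move=> xy; rewrite -expRD -expR0 ler_expR subr_ge0.
by rewrite ler_wpM2l// ltW.
Qed.

Let exp_sq (x : R) : 0 < x -> expR (- (s * x)) ^+ 2 <= expR (- (s * x)).
Proof.
move=> x0; rewrite expr2 ler_piMr ?expR_ge0// expR_le1.
by rewrite oppr_le0 mulr_ge0// ltW.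
Qed.

(** One exponential bounds both branches of the Green function, so that square
    integrability is checked once for all of the half-line. *)
Lemma green_decay (x : R) : 0 < x -> (green x * x) ^+ 2 <= K * expR (- (s * x)).
Proof.
move=> x0; rewrite /green mulfVK ?gt_eqF//.
have e0 := expR_gt0 (- (s * x)); have E0 := expR_gt0 (s * y).
have Bs := sqr_ge0 B; have Ys := sqr_ge0 (y^-1 + s).
have Y2 : 0 <= y ^- 2 by rewrite invr_ge0 sqr_ge0.
case: ifPn => [xy|_].
  have /andP[h0 h1] := exp_comb_left x0 xy.
  apply: (@le_trans _ _ 1).
    rewrite expr_le1//; apply: le_trans h1 _.
    by rewrite ler_pdivrMr// mul1r.
  apply: le_trans (exp_ge1 xy) _; rewrite ler_pM2r//.
  have := mulr_ge0 (ltW E0) Y2; have := mulr_ge0 Bs Ys.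
  rewrite /K; lra.
rewrite exp_comb_right exprMn.
apply: le_trans (ler_wpM2l Bs (exp_sq x0)) _; rewrite ler_pM2r//.
rewrite /K mulrDr [X in _ <= _ + X]mulrDr mulr1.
have : 0 <= expR (s * y) * y ^- 2 by rewrite mulr_ge0// ltW.
have := mulr_ge0 Bs Ys; lra.
Qed.

Lemma green_flux_decay (x : R) : 0 < x ->
  (green_flux x / x) ^+ 2 <= K * expR (- (s * x)).
Proof.
move=> x0; rewrite /green_flux.
have e0 := expR_gt0 (- (s * x)); have E0 := expR_gt0 (s * y).
have Bs := sqr_ge0 B; have Ys := sqr_ge0 (y^-1 + s).
have Y2 : 0 <= y ^- 2 by rewrite invr_ge0 sqr_ge0.
case: ifPn => [xy|]; last rewrite -ltNge => yx.
  apply: (@le_trans _ _ (y ^- 2)).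
    rewrite -exprVn -real_normK ?num_real// lerXn2r ?nnegrE ?invr_ge0 ?(ltW y0)//.
    rewrite normrM (gtr0_norm (_ : 0 < x^-1)) ?invr_gt0//.
    rewrite ler_pdivrMr// mulrC; exact: exp_comb_flux_left.
  apply: (@le_trans _ _ (expR (s * y) * y ^- 2 * expR (- (s * x)))).
    by rewrite mulrAC ler_peMl// exp_ge1.
  rewrite ler_pM2r// /K; have := mulr_ge0 Bs Ys; lra.
rewrite exp_comb_flux_right.
rewrite (_ : _ / x = - (B * (x^-1 + s) * expR (- (s * x)))); last first.
  by field; rewrite gt_eqF.
rewrite sqrrN exprMn.
apply: (@le_trans _ _ ((B * (x^-1 + s)) ^+ 2 * expR (- (s * x)))).
  by rewrite ler_wpM2l ?sqr_ge0// exp_sq.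
rewrite ler_pM2r// exprMn.
apply: (@le_trans _ _ (B ^+ 2 * (y^-1 + s) ^+ 2)).
  have x'0 : 0 <= x^-1 by rewrite invr_ge0 ltW.
  have y'0 : 0 <= y^-1 by rewrite invr_ge0 ltW.
  rewrite ler_wpM2l// lerXn2r ?nnegrE ?addr_ge0 ?(ltW s0)//.
  by rewrite lerD2r lef_pV2 ?posrE// (ltW yx).
have : 0 <= expR (s * y) * y ^- 2 by rewrite mulr_ge0// ltW.
rewrite /K; lra.
Qed.

Let exp_comb_continuous (a b : R) : continuous (exp_comb a b).
Proof.
move=> x; apply: differentiable_continuous; apply/derivable1_diffP.
by have [] := is_derive_exp_comb a b x.
Qed.

Let exp_comb_flux_continuous (a b : R) : continuous (exp_comb_flux a b).
Proof.
move=> x; apply: differentiable_continuous; apply/derivable1_diffP.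
by have [] := is_derive_exp_comb_flux a b x.
Qed.

Let exp_comb_flux_loc_abs_continuous (a b : R) :
  loc_abs_continuous (exp_comb_flux a b).
Proof.
move=> p q p0 pq.
have [|x _|L L0 H] := @C1_lipschitz R (exp_comb_flux a b)
    (fun x => x * s ^+ 2 * exp_comb a b x) p q pq.
- apply: continuous_subspaceT => x; apply: cvgM; last exact: exp_comb_continuous.
  by apply: cvgM; [exact: cvg_id|exact: cvg_cst].
- exact: is_derive_exp_comb_flux.
exact: lipschitz_abs_continuous L0 H.
Qed.

Let exp_comb_quot_lipschitz (a b p q : R) : 0 < p -> p <= q ->
  exists2 L, 0 <= L & forall x z, p <= x -> x <= z -> z <= q ->
    `|exp_comb a b z / z - exp_comb a b x / x| <= L * (z - x).
Proof.
move=> p0 pq; apply: (@C1_lipschitz R (fun x => exp_comb a b x / x)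
    (fun x => exp_comb_flux a b x / x ^+ 2) p q pq).
- apply: continuous_in_subspaceT => x; rewrite inE/= in_itv/= => /andP[px _].
  apply: cvgM; first exact: exp_comb_flux_continuous.
  apply: cvgV; first by rewrite expf_neq0// gt_eqF// (lt_le_trans p0).
  exact: exprn_continuous.
- by move=> x px; apply: is_derive_exp_comb_quot; rewrite gt_eqF// (lt_le_trans p0).
Qed.

(** Both branches are locally Lipschitz and they agree at [y]. *)
Lemma green_loc_abs_continuous : loc_abs_continuous green.
Proof.
move=> p q p0 pq.
have [L L0 HL] := exp_comb_quot_lipschitz A (- A) p0 pq.
have [M M0 HM] := exp_comb_quot_lipschitz 0 B p0 pq.
apply: (@lipschitz_abs_continuous _ _ _ _ (L + M)); first exact: addr_ge0.
move=> x z px xz zq; rewrite /green.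
have Lz : L * (z - x) <= (L + M) * (z - x) by rewrite ler_wpM2r ?subr_ge0 ?lerDl.
have Mz : M * (z - x) <= (L + M) * (z - x) by rewrite ler_wpM2r ?subr_ge0 ?lerDr.
have [zy|yz] := leP z y.
  by rewrite (le_trans xz zy); apply: le_trans (HL _ _ px xz zq) Lz.
have [xy|yx] := leP x y; last by apply: le_trans (HM _ _ px xz zq) Mz.
rewrite (_ : _ - _ = (exp_comb 0 B z / z - exp_comb 0 B y / y) +
  (exp_comb A (- A) y / y - exp_comb A (- A) x / x)); last by rewrite AB; ring.
have yq : y <= q by exact: le_trans (ltW yz) zq.
have py : p <= y by exact: le_trans px xy.
apply: le_trans (ler_normD _ _) _.
have h1 := HM _ _ py (ltW yz) zq; have h2 := HL _ _ px xy yq.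
have h3 : M * (z - y) <= M * (z - x) by rewrite ler_wpM2l// lerD2l lerN2.
have h4 : L * (y - x) <= L * (z - x) by rewrite ler_wpM2l// lerD2r ltW.
rewrite [leRHS]mulrDl [leLHS]addrC; apply: lerD.
  exact: le_trans h2 h4.
exact: le_trans h1 h3.
Qed.

Lemma derive1_green (x : R) : 0 < x -> x != y ->
  derive1 green x = green_flux x / x ^+ 2.
Proof.
move=> x0 xy; have x0' : x != 0 by rewrite gt_eqF.
rewrite /green_flux derive1E; case: ifPn xy => [xley|]; last rewrite -ltNge => xy _.
  rewrite neq_lt [y < x]ltNge xley orbF => xy.
  rewrite (near_eq_derive 1 (g := fun x => exp_comb A (- A) x / x)).
    by have [] := is_derive_exp_comb_quot A (- A) x0'.
  by near=> z; rewrite /green ifT//; apply/ltW; near: z; exact: lt_nbhsl.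
rewrite (near_eq_derive 1 (g := fun x => exp_comb 0 B x / x)).
  by have [] := is_derive_exp_comb_quot 0 B x0'.
by near=> z; rewrite /green ifF//; apply/negbTE; rewrite -ltNge; near: z; exact: lt_nbhsr.
Unshelve. all: by end_near. Qed.

Let mI : measurable I0y. Proof. exact: measurable_itv. Qed.

Let integrable_exp : mu.-integrable I0y (EFin \o (fun x => expR (- (s * x)))).
Proof.
apply: (@eq_integrable _ _ _ mu I0y mI
    (EFin \o (fun x => s^-1 * exponential_pdf s x))).
  move=> x; rewrite inE/= in_itv/= andbT => x0.
  rewrite /= exponential_pdfE ?(ltW x0)// mulrA mulVf ?gt_eqF// mul1r.
  by rewrite mulNr.
apply: integrable_EFinZ => //.
exact: integrableS (integrable_exponential_pdf s0).
Qed.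

Let exp_dominated f (L : R) : measurable_fun I0y f ->
  (forall x, 0 <= f x) ->
  (forall x, 0 < x -> x != y -> f x <= L * expR (- (s * x))) ->
  (\int[mu]_(x in I0y) (f x)%:E < +oo)%E.
Proof.
move=> mf f0 fL.
have iL := integrable_EFinZ L mI integrable_exp.
have iLa := integrable_norm iL.
apply: (@le_lt_trans _ _
  (\int[mu]_(x in I0y) (`|L * expR (- (s * x))|)%:E)%E); last first.
  exact: integrable_lty iLa.
apply: ae_ge0_le_integral => //.
- by move=> x _; rewrite lee_fin.
- exact/measurable_EFinP.
- exact: measurable_int iLa.
exists [set y]; split; [exact: measurable_set1|exact: lebesgue_measure_set1|].
move=> x /= nx; apply: contrapT => /eqP xy; apply: nx; rewrite in_itv/= andbT => x0.
by rewrite lee_fin (le_trans (fL _ x0 xy))// ler_norm.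
Qed.

Lemma green_bessel_dom : bessel_dom green.
Proof.
split; first exact: green_loc_abs_continuous.
- apply: (@exp_dominated _ (2 * K)).
    apply: measurable_funM.
      apply: measurable_funX.
      exact: loc_abs_continuous_measurable green_loc_abs_continuous.
    by apply: measurable_funM => //; exact: exprn_measurable.
    by move=> x; rewrite mulr_ge0 ?sqr_ge0// mulr_ge0 ?sqr_ge0.
  move=> x x0 _; have := green_decay x0; rewrite exprMn; lra.
- apply: (@exp_dominated _ K).
    apply: measurable_funM; last exact: exprn_measurable.
    apply: measurable_funX.
    exact: loc_abs_continuous_measurable_derive1 green_loc_abs_continuous.
    by move=> x; rewrite mulr_ge0 ?sqr_ge0.
  move=> x x0 xy; rewrite derive1_green//.
  rewrite [leLHS](_ : _ = (green_flux x / x) ^+ 2) ?green_flux_decay//.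
  by field; rewrite gt_eqF.
Qed.

Variable lam : R.
Hypothesis lamE : s ^+ 2 = 2 * lam.

Let energy w x : R :=
  derive1 w x * derive1 green x * x ^+ 2 + lam * (w x * green x * (2 * x ^+ 2)).

Let energy_integrable w : bessel_dom w -> mu.-integrable I0y (EFin \o energy w).
Proof.
move=> Dw; apply: integrable_EFinD => //.
  exact: bessel_integrable_derive green_bessel_dom.
by apply: integrable_EFinZ => //; exact: bessel_integrable green_bessel_dom.
Qed.

Let bessel_form_energy w : bessel_dom w ->
  bessel_form lam w green = \int[mu]_(x in I0y) energy w x.
Proof.
move=> Dw; rewrite /bessel_form /energy -RintegralZl//; last first.
  exact: bessel_integrable green_bessel_dom.
rewrite -RintegralD//.
  exact: bessel_integrable_derive green_bessel_dom.
by apply: integrable_EFinZ => //; exact: bessel_integrable green_bessel_dom.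
Qed.

(** Away from [y] the energy density is the derivative of w times the flux. *)
Let energy_flux w (a b x : R) : 0 < x -> x != y ->
  green x = exp_comb a b x / x -> green_flux x = exp_comb_flux a b x ->
  energy w x = derive1 w x * exp_comb_flux a b x +
    w x * derive1 (exp_comb_flux a b) x.
Proof.
move=> x0 xy gE fE; rewrite /energy derive1_green// gE fE.
have -> : derive1 (exp_comb_flux a b) x = x * s ^+ 2 * exp_comb a b x.
  by rewrite derive1E; have [_ ->] := is_derive_exp_comb_flux a b x.
by rewrite lamE; field; rewrite gt_eqF.
Qed.

Let energy_left w (e : R) : bessel_dom w -> 0 < e -> e <= y ->
  \int[mu]_(x in `]e, y]) energy w x =
  w y * exp_comb_flux A (- A) y - w e * exp_comb_flux A (- A) e.
Proof.
move=> Dw e0 ey; have [wAC _ _] := Dw.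
have [iwf <-] := integration_by_parts_loc_abs_continuous wAC
  (exp_comb_flux_loc_abs_continuous A (- A)) e0 ey.
have sub : `]e, y[%classic `<=` I0y.
  by move=> x /=; rewrite !in_itv/= andbT => /andP[ex _]; exact: lt_trans ex.
rewrite -[LHS]Rintegral_itv_bndo_bndc; last first.
  exact: integrableS (energy_integrable Dw).
rewrite -[RHS]Rintegral_itv_bndo_bndc; last first.
  by apply: integrableS iwf => //; apply: subset_itvl; rewrite bnd_simp.
apply: eq_Rintegral => x; rewrite inE/= in_itv/= => /andP[ex xy].
apply: energy_flux; first exact: lt_trans ex.
- by rewrite lt_eqF.
- by rewrite /green (ltW xy).
- by rewrite /green_flux (ltW xy).
Qed.

Let energy_right w (T : R) : bessel_dom w -> y <= T ->
  \int[mu]_(x in `]y, T]) energy w x =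
  w T * exp_comb_flux 0 B T - w y * exp_comb_flux 0 B y.
Proof.
move=> Dw yT; have [wAC _ _] := Dw.
have [iwf <-] := integration_by_parts_loc_abs_continuous wAC
  (exp_comb_flux_loc_abs_continuous 0 B) y0 yT.
apply: eq_Rintegral => x; rewrite inE/= in_itv/= => /andP[yx xT].
apply: energy_flux; first exact: lt_trans yx.
- by rewrite gt_eqF.
- by rewrite /green leNgt yx.
- by rewrite /green_flux leNgt yx.
Qed.

(** The boundary terms at [y] add up to w(y), by [exp_comb_flux_jump]. *)
Let energy_itv w (e T : R) : bessel_dom w -> 0 < e -> e <= y -> y <= T ->
  \int[mu]_(x in `]e, T]) energy w x =
  w y + w T * exp_comb_flux 0 B T - w e * exp_comb_flux A (- A) e.
Proof.
move=> Dw e0 ey yT.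
have ie : mu.-integrable `]e, T] (EFin \o energy w).
  apply: integrableS (energy_integrable Dw) => //.
  by move=> x /=; rewrite !in_itv/= andbT => /andP[ex _]; exact: lt_trans ex.
have := @Rintegral_itvB _ (energy w) (BRight e) (BRight T) y ie.
rewrite !bnd_simp => /(_ ey yT); rewrite energy_left// energy_right//.
have := exp_comb_flux_jump.
set I := \int[mu]_(t in _) _ t; set p := exp_comb_flux A _ y => jump /eqP.
by rewrite subr_eq => /eqP ->; rewrite -[in RHS](mulr1 (w y)) -jump; ring.
Qed.

Let flux_right_decay (T : R) : 0 < T -> `|exp_comb_flux 0 B T| <= 4 * B / s * T^-1.
Proof.
move=> T0; rewrite exp_comb_flux_right normrN.
have sT0 := mulr_gt0 s0 T0.
rewrite ger0_norm; last first.
  by rewrite (mulr_ge0 (ltW B0))// mulr_ge0 ?expR_ge0// addr_ge0// ltW.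
rewrite (_ : 4 * B / s / T = B * (4 / (s * T))); last by field; rewrite !gt_eqF.
rewrite ler_wpM2l ?(ltW B0)// expRN ler_pdivlMr// -mulrA [leLHS]mulrC.
rewrite ler_pdivrMr ?expR_gt0//.
have := @expR_ge1Dxn R (s * T) 1 (ltW sT0).
have := sqr_ge0 (s * T); rewrite (_ : 2`!%:R = 2)//; nra.
Qed.

(** On ]e, T] the energy is w(y) up to boundary terms at the two ends.  At [e] the
    flux is O(e) while w(e) is O(1 / sqrt e); at [T] the flux is O(1 / T) and w
    is bounded. *)
Lemma green_reproducing w : bessel_dom w -> bessel_form lam w green = w y.
Proof.
move=> Dw; have [wAC _ _] := Dw.
rewrite bessel_form_energy//.
(* With eta = n+1 and e = 1/(n+1)^2 the bound on w(e) is of order n+1, so that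
   w(e) times the flux, which is at most e/y, is of order 1/(n+1). *)
pose e n : R := n.+1%:R^-1 ^+ 2; pose T n : R := n.+1%:R.
have e0 n : 0 < e n by rewrite exprn_gt0// invr_gt0.
have eto0 : e n @[n --> \oo] --> 0.
  rewrite -(mulr0 (0 : R)); apply: cvgM; exact: cvg_harmonic.
have Ttoy : T n @[n --> \oo] --> +oo.
  by have := @cvgr_idn R; rewrite -(cvg_shiftS (fun n => n%:R : R)).
have cv := cvg_Rintegral_exhaust (energy_integrable Dw) e0 eto0 Ttoy.
apply: (cvg_unique _ cv) => //.
have iw := bessel_integrable_derive Dw Dw.
have inc := loc_abs_continuous_increment wAC iw.
pose W := \int[mu]_(x in I0y) (derive1 w x * derive1 w x * x ^+ 2).
pose C1 := (`|w y| + (1 * W + (1 * y)^-1) / 2) * (4 * B / s).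
pose C2 := (`|w y| + (W + 1) / 2) / y.
have CN n : y <= T n -> `|w (T n) * exp_comb_flux 0 B (T n)| <= C1 * harmonic n.
  move=> yT; rewrite normrM /C1 -mulrA; apply: ler_pM => //.
    rewrite -[in leLHS](subrK (w y) (w (T n))) addrC.
    rewrite (le_trans (ler_normD _ _))// lerD2l.
    exact: inc.
  by apply: flux_right_decay; rewrite /T.
have CE n : e n <= y -> `|w (e n) * exp_comb_flux A (- A) (e n)| <= C2 * harmonic n.
  move=> ey; rewrite normrM.
  have h0 : 0 < n.+1%:R^-1 :> R by rewrite invr_gt0.
  have h1 : n.+1%:R^-1 <= 1 :> R by rewrite invf_le1// ler1n.
  have we : `|w (e n)| <= `|w y| + (n.+1%:R * W + n.+1%:R) / 2.
    rewrite -[in leLHS](subrK (w y) (w (e n))) addrC.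
    rewrite (le_trans (ler_normD _ _))// lerD2l distrC.
    have := inc n.+1%:R (e n) y (ltr0Sn _ _) (e0 n) ey.
    by rewrite {2}/e expr2 mulrA mulfV// mul1r invrK.
  apply: le_trans (ler_pM _ _ we (exp_comb_flux_left (e0 n) ey)) _ => //.
  rewrite /C2 /e /harmonic/= -/W.
  have E (q : R) : q != 0 -> (`|w y| + (q^-1 * W + q^-1) / 2) * (q ^+ 2 / y) =
      (`|w y| * q + (W + 1) / 2) / y * q.
    by move=> q0; field; rewrite q0 gt_eqF.
  have := E n.+1%:R^-1; rewrite invrK gt_eqF// => -> //.
  rewrite ler_pM2r// ler_pM2r ?invr_gt0// lerD2r.
  by rewrite ler_piMr.
have hC : (C1 + C2) * harmonic n @[n --> \oo] --> 0.
  by rewrite -(mulr0 (C1 + C2)); apply: cvgM; [exact: cvg_cst|exact: cvg_harmonic].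
apply/cvgrPdist_le => d d0; near=> n.
have ey : e n <= y by near: n; exact: (cvgr_le 0).
have yT : y <= T n by near: n; move/cvgryPge: Ttoy; exact.
rewrite energy_itv// -addrA opprD addrA subrr sub0r normrN.
apply: le_trans (ler_normB _ _) _.
apply: le_trans (lerD (CN n yT) (CE n ey)) _; rewrite -mulrDl.
apply: le_trans (ler_norm _) _; near: n; exact: cvgr0_norm_le.
Unshelve. all: by end_near. Qed.

End Green.

(** * Pointwise bound for the approximating trace forms *)

Section Trace.
Context {R : realType}.
Local Notation mu := (@lebesgue_measure R).
Local Notation I0y := (`]0, +oo[%classic : set R).
Implicit Types (f g h u v w : R -> R).

Lemma loc_abs_continuousB u v : loc_abs_continuous u -> loc_abs_continuous v ->
  loc_abs_continuous (u \- v).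
Proof.
move=> uAC vAC a b a0 ab e e0; have e20 : 0 < e / 2 by rewrite divr_gt0.
have [d1 d10 H1] := uAC _ _ a0 ab _ e20.
have [d2 d20 H2] := vAC _ _ a0 ab _ e20.
exists (Num.min d1 d2); first by rewrite lt_min d10.
move=> s so sn; rewrite lt_min => /andP[/(H1 _ so sn) s1 /(H2 _ so sn) s2].
apply: le_lt_trans (_ : _ <= \sum_(t <- s) `|u t.2 - u t.1| +
  \sum_(t <- s) `|v t.2 - v t.1|) _; last by rewrite (splitr e) ltrD.
rewrite -big_split/=; apply: ler_sum => t _.
rewrite [X in `|X|](_ : _ = (u t.2 - u t.1) - (v t.2 - v t.1)); last by ring.
exact: ler_normB.
Qed.

Let mI : measurable I0y. Proof. exact: measurable_itv. Qed.

Let square_integralB f g k h : measurable_fun I0y f -> measurable_fun I0y g ->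
  measurable_fun I0y k -> measurable_fun I0y h -> (forall x, 0 <= h x) ->
  {ae mu, forall x, I0y x -> k x = f x - g x} ->
  (\int[mu]_(x in I0y) (f x ^+ 2 * h x)%:E < +oo)%E ->
  (\int[mu]_(x in I0y) (g x ^+ 2 * h x)%:E < +oo)%E ->
  (\int[mu]_(x in I0y) (k x ^+ 2 * h x)%:E < +oo)%E.
Proof.
move=> mf mg mk mh h0 kE fy gy.
have iff := integrable_EFinZ 2 mI (square_integrableM mf mf mh h0 fy fy).
have igg := integrable_EFinZ 2 mI (square_integrableM mg mg mh h0 gy gy).
have ifg := integrable_EFinD mI iff igg.
apply: (@le_lt_trans _ _ (\int[mu]_(x in I0y)
  (2 * (f x * f x * h x) + 2 * (g x * g x * h x))%:E)%E); last first.
  exact: integrable_lty ifg.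
apply: ae_ge0_le_integral => //.
- by move=> x _; rewrite lee_fin mulr_ge0// sqr_ge0.
- apply/measurable_EFinP; apply: measurable_funM => //; exact: measurable_funX.
- move=> x _; have sq q : 0 <= (q : R) * q * h x by rewrite mulr_ge0// -expr2 sqr_ge0.
  by rewrite lee_fin addr_ge0// mulr_ge0.
- exact: measurable_int ifg.
move: kE; apply: filterS; first exact: (ae_filter_ringOfSetsType mu).
move=> x kE Ix; rewrite lee_fin kE//.
by have := h0 x; have := sqr_ge0 (f x + g x); nra.
Qed.

(** The derivative is linear only where both functions are differentiable, hence
    almost everywhere. *)
Lemma bessel_domB u v : bessel_dom u -> bessel_dom v -> bessel_dom (u \- v).
Proof.
move=> [uAC u2 u'2] [vAC v2 v'2].
have AC := loc_abs_continuousB uAC vAC.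
have mx : measurable_fun I0y (fun x : R => x ^+ 2) by exact: exprn_measurable.
split; first exact: AC.
- apply: (square_integralB _ _ _ _ _ _ u2 v2).
  + exact: loc_abs_continuous_measurable.
  + exact: loc_abs_continuous_measurable.
  + exact: loc_abs_continuous_measurable.
  + exact: measurable_funM.
  + by move=> x; rewrite mulr_ge0// sqr_ge0.
  + exact: aeW.
- apply: (square_integralB _ _ _ _ _ _ u'2 v'2).
  + exact: loc_abs_continuous_measurable_derive1.
  + exact: loc_abs_continuous_measurable_derive1.
  + exact: loc_abs_continuous_measurable_derive1.
  + exact: mx.
  + by move=> x; exact: sqr_ge0.
  + have := loc_abs_continuous_ae_derivable vAC.
    have := loc_abs_continuous_ae_derivable uAC.
    apply: filterS2; first exact: (ae_filter_ringOfSetsType mu).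
    move=> x ux vx; rewrite /= in_itv/= andbT => x0.
    by rewrite !derive1E; exact: deriveB (ux x0) (vx x0).
Qed.

Lemma bessel_formC (lam : R) u v : bessel_form lam u v = bessel_form lam v u.
Proof.
have E (f g h : R -> R) : \int[mu]_(x in I0y) (f x * g x * h x) =
    \int[mu]_(x in I0y) (g x * f x * h x).
  by apply: eq_Rintegral => x _; rewrite [f x * _]mulrC.
exact: (f_equal2 (fun p q => p + lam * q) (E _ _ _) (E _ _ _)).
Qed.

(** The Green function at y = k+1 is orthogonal to ker J, so it does not distinguish
    [u] from its projection [v].  The bound is then [bessel_form_young] for [v] and
    the Green function; t = y v(y) is the best parameter once green(y) has been
    replaced by its bound 1/y. *)
Lemma bessel_proj_bound (lam : R) u v k : 0 < lam -> bessel_dom u ->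
  is_bessel_proj lam (bessel_orth lam (@trace_ker R)) u v ->
  k.+1%:R * restrN u k ^+ 2 <= bessel_form lam v v.
Proof.
move=> lam0 Du [[Dv _] uv].
pose s := Num.sqrt (2 * lam); have s0 : 0 < s by rewrite sqrtr_gt0 mulr_gt0.
have sE : s ^+ 2 = 2 * lam by rewrite sqr_sqrtr// mulr_ge0// ltW.
pose y : R := k.+1%:R; have y0 : 0 < y by [].
have DG := green_bessel_dom s0 y0.
have rep := green_reproducing s0 y0 sE.
have GM : bessel_orth lam (@trace_ker R) (green s y).
  by split=> // w [Dw w0]; rewrite bessel_formC rep//; exact: w0.
have vy : v y = u y.
  have := uv _ GM; rewrite rep; last exact: bessel_domB.
  by move=> /= /eqP; rewrite subr_eq0 => /eqP.
have := bessel_form_young (y * v y) (ltW lam0) Dv DG.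
rewrite !rep//.
have := green_at s0 y0; rewrite /restrN -/y -vy.
move: (bessel_form lam v v) (green s y y) => F g gy H.
have : (y * v y) ^+ 2 * g <= y * v y ^+ 2.
  rewrite (_ : y * v y ^+ 2 = (y * v y) ^+ 2 * y^-1); last by field; rewrite gt_eqF.
  by rewrite ler_wpM2l// sqr_ge0.
by move: H; rewrite expr2; lra.
Qed.

Lemma trace_approx_ge (a : nat -> R) (lam : R) (f : nat -> R) k : 0 < lam ->
  ((k.+1%:R * f k ^+ 2)%:E <= trace_approx a lam f)%E.
Proof.
move=> lam0; rewrite /trace_approx; case: xgetP => [c _|_]; last by rewrite leey.
move=> [u [v [[Du _] <- uv ->]]]; rewrite lee_fin.
exact: bessel_proj_bound.
Qed.
End Trace.

(** * Pointwise bound for the trace form and compactness *)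

Section Compactness.
Context {R : realType}.
Implicit Types (a f g h : nat -> R) (p C : R).

Lemma lp_norm_ge_term a p h k : 0 < p -> (forall k, 0 < a k) ->
  ((a k `^ p^-1 * `|h k|)%:E <= lp_norm a p h)%E.
Proof.
move=> p0 a0; rewrite /lp_norm.
have t0 j : (0 <= (a j * `|h j| `^ p)%:E)%E.
  by rewrite lee_fin mulr_ge0 ?powR_ge0// ltW.
have -> : a k `^ p^-1 * `|h k| = (a k * `|h k| `^ p) `^ p^-1.
  by rewrite powRM ?powR_ge0 ?(ltW (a0 k))// -powRrM divff ?gt_eqF// powRr1.
rewrite -poweR_EFin; apply: gt0_ler_poweR.
- by rewrite invr_ge0 ltW.
- by rewrite in_itv/= leey andbT.
- by rewrite in_itv/= leey andbT nneseries_ge0.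
apply: le_trans (nneseries_lim_ge k.+1 _) => //.
rewrite big_nat_recr//= leeDr// sume_ge0//.
Qed.

Lemma lp_cvg_pointwise a p (f_ : nat -> nat -> R) f k : 0 < p ->
  (forall k, 0 < a k) -> lp_cvg a p f_ f -> f_ n k @[n --> \oo] --> f k.
Proof.
move=> p0 a0 f_f.
have ap0 : 0 < a k `^ p^-1 by rewrite powR_gt0.
have H : (a k `^ p^-1 * `|f_ n k - f k|)%:E @[n --> \oo] --> 0%:E.
  apply: (squeeze_cvge _ (cvg_cst _) f_f); apply: nearW => n.
  rewrite lee_fin mulr_ge0 ?powR_ge0//=.
  exact: (@lp_norm_ge_term a p (f_ n \- f)).
have {}H : a k `^ p^-1 * `|f_ n k - f k| @[n --> \oo] --> 0.
  exact: fine_cvg H.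
apply/subr_cvg0; apply: norm_cvg0.
have : (a k `^ p^-1)^-1 * (a k `^ p^-1 * `|f_ n k - f k|) @[n --> \oo] -->
    (a k `^ p^-1)^-1 * 0 by apply: cvgM => //; exact: cvg_cst.
rewrite mulr0; under eq_fun do rewrite mulKf ?gt_eqF//.
exact.
Qed.

(** If the inequality failed, the approximating forms would stay below the limit
    value of (k+1) * f_n(k)^2 along a recovery sequence, against
    [trace_approx_ge]. *)
Lemma trace_form_ge a (Q : (nat -> R) -> \bar R) f k : (forall k, 0 < a k) ->
  is_trace_form a Q -> lp a 2 f -> ((k.+1%:R * f k ^+ 2)%:E <= Q f)%E.
Proof.
move=> a0 QT f2; rewrite leNgt; apply/negP => Qlt.
pose lam n : R := harmonic n.
have lam0 n : 0 < lam n by rewrite /lam/= invr_gt0.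
have [_ /(_ f f2)[f_ [_ f_f Qle]]] := QT lam lam0 (@cvg_harmonic R).
have := le_lt_trans Qle Qlt.
rewrite /limn_esup /limf_esup => /ereal_inf_lt[_ [V Voo <-] VQ].
move: VQ; apply/negP; rewrite -leNgt.
have fk : (k.+1%:R * f_ n k ^+ 2)%:E @[n --> \oo] --> (k.+1%:R * f k ^+ 2)%:E.
  apply: cvg_EFin; first exact: nearW.
  apply: cvgM; first exact: cvg_cst.
  by apply: cvgM; apply: lp_cvg_pointwise f_f.
apply: (cvge_to_le fk).
move: Voo; apply: filterS => n Vn.
apply: le_trans (trace_approx_ge a (f_ n) k (lam0 n)) _.
by apply: ereal_sup_ubound; exists n.
Qed.
Lemma powR_term_le a p C (x : R) k : 0 <= p -> 0 < a k ->
  k.+1%:R * x ^+ 2 <= C ->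
  a k * `|x| `^ p <= C `^ (p / 2) * (a k / k.+1%:R `^ (p / 2)).
Proof.
move=> p0 a0 xC; rewrite mulrCA ler_pM2l// ler_pdivlMr ?powR_gt0//.
have -> : `|x| `^ p = (x ^+ 2) `^ (p / 2).
  rewrite -real_normK ?num_real// -powR_mulrn// -powRrM.
  by congr (_ `^ _); rewrite mulrC divfK.
rewrite mulrC -powRM ?sqr_ge0//.
have x0 : 0 <= k.+1%:R * x ^+ 2 by rewrite mulr_ge0// sqr_ge0.
apply: ge0_ler_powR => //; first by rewrite divr_ge0.
by rewrite nnegrE; exact: le_trans xC.
Qed.

Lemma lp_of_decay a p C f : 0 <= p -> (forall k, 0 < a k) ->
  (\sum_(k <oo) (a k / k.+1%:R `^ (p / 2))%:E < +oo)%E ->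
  (forall k, k.+1%:R * f k ^+ 2 <= C) -> lp a p f.
Proof.
move=> p0 a0 sa fC; rewrite /lp/=.
have t0 k : (0 <= (a k / k.+1%:R `^ (p / 2))%:E)%E.
  by rewrite lee_fin divr_ge0 ?powR_ge0// ltW.
apply: (@le_lt_trans _ _
  (\sum_(k <oo) ((C `^ (p / 2))%:E * (a k / k.+1%:R `^ (p / 2))%:E))%E).
  apply: lee_nneseries => [k _ _|k _]; last exact: powR_term_le.
  by rewrite lee_fin mulr_ge0 ?powR_ge0// ltW.
by rewrite nneseriesZl// lte_mul_pinfty// lee_fin powR_ge0.
Qed.

Lemma form_norm_le a (Q : (nat -> R) -> \bar R) f (M : R) :
  (0 <= Q f)%E -> (form_norm a Q f <= M%:E)%E -> (Q f <= (M ^+ 2)%:E)%E.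
Proof.
move=> Q0; rewrite /form_norm.
set S := (Q f + _)%E => SM.
have n0 : (0 <= lp_norm a 2 f)%E by exact: poweR_ge0.
have S0 : (0 <= S)%E by rewrite adde_ge0// expe_ge0.
have M0 : 0 <= M by rewrite -lee_fin (le_trans (poweR_ge0 _ _) SM).
apply: (@le_trans _ _ S); first by rewrite leeDl// expe_ge0.
have -> : S = ((S `^ 2^-1) `^ 2)%E.
  by rewrite -poweRrM mulVf// poweRe1.
rewrite -powR_mulrn// -poweR_EFin.
by apply: gt0_ler_poweR => //; rewrite in_itv/= leey andbT ?poweR_ge0// lee_fin.
Qed.

(** The set defined by the bound is compact for pointwise convergence, being a
    product of compact sets; a neighbourhood of the cluster point in the product
    controls finitely many coordinates. *)
Lemma decay_cluster (f_ : nat -> nat -> R) C :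
  (forall n k, k.+1%:R * f_ n k ^+ 2 <= C) ->
  exists2 g, (forall k, k.+1%:R * g k ^+ 2 <= C) &
    forall N n0 (d : R), 0 < d ->
      exists2 n, (n0 <= n)%N & forall k, (k < N)%N -> `|f_ n k - g k| < d.
Proof.
move=> fC.
pose A (k : nat) := [set x : R | k.+1%:R * x ^+ 2 <= C].
have cA k : compact (A k).
  apply: (@subclosed_compact _ _ `[- (C + 1), C + 1]).
  - apply: (@preimage_closed _ _ (fun x : R => k.+1%:R * x ^+ 2) [set y : R | y <= C]).
      by move=> x _; apply: cvgM; [exact: cvg_cst|exact: exprn_continuous].
    exact: closed_le.
  - exact: segment_compact.
  - move=> x /= xC; have k1 : 1 <= k.+1%:R :> R by rewrite ler1n.
    have x2 := sqr_ge0 x.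
    have {k1 xC} : x ^+ 2 <= C by apply: le_trans xC; rewrite ler_peMl.
    by rewrite in_itv/= => xC; apply/andP; split; nra.
have cK := tychonoff cA.
pose F : nat -> prod_topology (fun _ : nat => R) := f_.
have [|g [gA gF]] := cK (F @ \oo) (fmap_proper_filter F eventually_filter).
  by exists 0%N => // n _ k; exact: fC.
exists g => [k|N n0 d d0]; first exact: gA.
have nB : \forall h \near g, forall k : 'I_N,
    `|h (nat_of_ord k) - g (nat_of_ord k)| < d.
  apply: (@filter_forall _ _ (fun (k : 'I_N) (h : prod_topology (fun _ : nat => R)) =>
    `|h (nat_of_ord k) - g (nat_of_ord k)| < d) _ (nbhs_filter g)) => k.
  have bg : nbhs (g (nat_of_ord k)) (ball (g (nat_of_ord k) : R) d).
    exact: nbhsx_ballx.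
  have pg := @proj_continuous nat (fun _ => R) k g _ bg.
  refine (@filterS _ _ (nbhs_filter g) _ _ _ pg) => h hg.
  by rewrite distrC; exact: hg.
have nF : (F @ \oo) [set f_ n | n in [set n | (n0 <= n)%N]].
  by exists n0 => // n /= n0n; exists n.
have [_ [[n n0n <-] H]] := gF _ _ nF nB.
by exists n => // k kN; exact: (H (Ordinal kN)).
Qed.

(** The tail of the series is dominated by that of a convergent series, whatever [n];
    the head is small because finitely many coordinates are close. *)
Lemma decay_lp_close a p C (f_ : nat -> nat -> R) g :
  0 < p -> (forall k, 0 < a k) ->
  (\sum_(k <oo) (a k / k.+1%:R `^ (p / 2))%:E < +oo)%E ->
  (forall n k, k.+1%:R * f_ n k ^+ 2 <= C) ->
  (forall k, k.+1%:R * g k ^+ 2 <= C) ->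
  (forall N n0 (d : R), 0 < d ->
      exists2 n, (n0 <= n)%N & forall k, (k < N)%N -> `|f_ n k - g k| < d) ->
  forall n0 (e : R), 0 < e -> exists2 n, (n0 <= n)%N &
    (\sum_(k <oo) (a k * `|f_ n k - g k| `^ p)%:E <= e%:E)%E.
Proof.
move=> p0 a0 sa fC gC close n0 e e0.
pose b k := (4 * C) `^ (p / 2) * (a k / k.+1%:R `^ (p / 2)).
have b0 k : 0 <= b k by rewrite mulr_ge0 ?divr_ge0 ?powR_ge0// ltW.
(* (x - y)^2 <= 2 x^2 + 2 y^2 accounts for the factor 4. *)
have fgb n k : a k * `|f_ n k - g k| `^ p <= b k.
  apply: powR_term_le; [exact: ltW|exact: a0|].
  have h1 := fC n k; have h2 := gC k.
  have k0 : 0 <= k.+1%:R :> R by [].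
  have := ler_wpM2l k0 (sqr_ge0 (f_ n k + g k)).
  by rewrite sqrrD sqrrB !mulrDr mulr0; lra.
have term0 n k : (0 <= (a k * `|f_ n k - g k| `^ p)%:E)%E.
  by rewrite lee_fin mulr_ge0 ?powR_ge0// ltW.
have sb : (\sum_(0 <= k <oo) (b k)%:E < +oo)%E.
  rewrite (eq_eseriesr (g := fun k => ((4 * C) `^ (p / 2))%:E *
    (a k / k.+1%:R `^ (p / 2))%:E)%E) => [|k _]; last by rewrite EFinM.
  rewrite nneseriesZl => [|k _]; last by rewrite lee_fin divr_ge0 ?powR_ge0// ltW.
  by rewrite lte_mul_pinfty// lee_fin powR_ge0.
have tb := nneseries_tail_cvg sb (fun k _ => b0 k : (0 <= (b k)%:E)%E).
have e20 : 0 < e / 2 by rewrite divr_gt0.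
have [N _ /(_ N (leqnn N)) /= HN] : \forall N \near \oo,
    (\sum_(N <= k <oo) (b k)%:E < (e / 2)%:E)%E.
  apply: (tb [set x | (x < (e / 2)%:E)%E]); apply: open_nbhs_nbhs; split=> /=.
    exact: open_ereal_lt_ereal.
  by rewrite lte_fin.
pose S := \sum_(0 <= k < N) a k.
have S0 : 0 <= S by rewrite sumr_ge0// => k _; exact: ltW.
have S1 : 0 < S + 1 by rewrite ltr_wpDl.
(* The 1 keeps the denominator positive when N = 0. *)
pose q := e / 2 / (S + 1); have q0 : 0 < q by rewrite divr_gt0.
have [n n0n Hn] := close N n0 (q `^ p^-1) (powR_gt0 _ q0).
exists n => //.
rewrite (@nneseries_split _ _ 0 N) => [|k _]; last exact: term0.
rewrite add0n (splitr e) EFinD leeD//.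
  rewrite sumEFin lee_fin; apply: (@le_trans _ _ (S * q)).
    rewrite /S mulr_suml !big_nat; apply: ler_sum => k /andP[_ kN].
    rewrite ler_wpM2l ?(ltW (a0 k))//.
    rewrite -[leRHS](powRr1 (ltW q0)) -(mulVf (lt0r_neq0 p0)) powRrM.
    by apply: ge0_ler_powR; rewrite ?nnegrE ?powR_ge0// ?(ltW p0)// ltW// Hn.
  by rewrite /q mulrCA ler_piMr ?(ltW e20)// ler_pdivrMr// mul1r lerDl.
apply: le_trans (ltW HN); apply: lee_nneseries => [k _ _|k _]; first exact: term0.
by rewrite lee_fin fgb.
Qed.

(** Greedy choice: each index is sought beyond the previous one. *)
Lemma subsequence_of_frequently (P : nat -> nat -> Prop) :
  (forall j n0, exists2 n, (n0 <= n)%N & P j n) ->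
  exists2 phi : nat -> nat, {homo phi : i j / (i < j)%N} & forall j, P j (phi j).
Proof.
move=> HP.
have /choice[F FP] : forall jn : nat * nat, exists n, (jn.2 <= n)%N /\ P jn.1 n.
  by move=> [j n0]; have [n ? ?] := HP j n0; exists n.
pose phi := fix phi j := if j is i.+1 then F (i.+1, (phi i).+1) else F (0%N, 0%N).
exists phi; last by case=> [|j]; [exact: (FP (0%N, 0%N)).2|exact: (FP (j.+1, _)).2].
apply: homo_ltn; first exact: ltn_trans.
by move=> j; exact: (FP (j.+1, (phi j).+1)).1.
Qed.

Lemma lp_cvg_of_powR_harmonic a p (f_ : nat -> nat -> R) g : 0 < p ->
  (forall k, 0 < a k) ->
  (forall j, (\sum_(k <oo) (a k * `|f_ j k - g k| `^ p)%:E <=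
    (harmonic j `^ p)%:E)%E) ->
  lp_cvg a p f_ g.
Proof.
move=> p0 a0 H; rewrite /lp_cvg.
apply: (@squeeze_cvge _ _ _ _ (cst 0%E) _ (fun j => (harmonic j)%:E)).
- apply: nearW => j; apply/andP; split; first exact: poweR_ge0.
  have h0 : 0 <= harmonic j :> R by rewrite /= invr_ge0.
  have -> : (harmonic j : R) = (harmonic j `^ p) `^ p^-1.
    by rewrite -powRrM mulfV ?gt_eqF// powRr1.
  rewrite -poweR_EFin; apply: gt0_ler_poweR; last exact: H.
  + by rewrite invr_ge0 ltW.
  + rewrite in_itv/= leey andbT nneseries_ge0// => k _ _.
    by rewrite lee_fin mulr_ge0 ?powR_ge0// ltW.
  + by rewrite in_itv/= leey andbT lee_fin powR_ge0.
- exact: cvg_cst.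
- by apply: cvg_EFin; [exact: nearW|exact: cvg_harmonic].
Qed.

End Compactness.

Unset Implicit Arguments.

Theorem proposition3p10 (R : realType) (a : nat -> R) (p : R)
    (Etr : (nat -> R) -> \bar R)
    (a_gt0 : forall k, 0 < a k)
    (Etr_trace : is_trace_form a Etr)
    (p_ge1 : 1 <= p)
    (a_summable : (\sum_(k <oo) (a k / k.+1%:R `^ (p / 2))%:E < +oo)%E) :
  compactly_embeds a Etr p.
Proof.
have p0 : 0 < p by exact: lt_le_trans p_ge1.
have Ege f k : lp a 2 f -> ((k.+1%:R * f k ^+ 2)%:E <= Etr f)%E.
  exact: trace_form_ge.
have E0 f : lp a 2 f -> (0 <= Etr f)%E.
  move=> f2; apply: le_trans (Ege f 0%N f2).
  by rewrite lee_fin mul1r sqr_ge0.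
split=> [f [f2 Ef]|f_ f_dom [M fM]].
  have Efin : Etr f \is a fin_num by rewrite ge0_fin_numE// E0.
  apply: (lp_of_decay (C := fine (Etr f)) (ltW p0)) => // k.
  by rewrite -lee_fin fineK// Ege.
have decay n k : k.+1%:R * f_ n k ^+ 2 <= M ^+ 2.
  have [fn2 _] := f_dom n; rewrite -lee_fin.
  exact: le_trans (Ege _ k fn2) (form_norm_le (E0 _ fn2) (fM n)).
have [g gM close] := decay_cluster decay.
have freq j n0 : exists2 n, (n0 <= n)%N &
    (\sum_(k <oo) (a k * `|f_ n k - g k| `^ p)%:E <= (harmonic j `^ p)%:E)%E.
  apply: (decay_lp_close p0 a_gt0 a_summable decay gM close).
  by rewrite powR_gt0// invr_gt0.
have [phi phi_incr phiP] := subsequence_of_frequently freq.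
exists phi; split=> //; exists g.
  exact: lp_of_decay (ltW p0) a_gt0 a_summable gM.
exact: (lp_cvg_of_powR_harmonic (f_ := f_ \o phi)).
Qed.
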